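(* Let $\overline{X}=(X_0,X_1)$ be a compatible (quasi-)Banach couple and let $0<\theta_0<\theta_1<1$. Let $E_0,E_1,F_0,F_1$ be r.i. spaces and let $a_0,a_1,b_0,b_1\in SV$ be such that $\|b_0\|_{\widetilde{E}_0(0,1)}<\infty$ and $\|b_1\|_{\widetilde{E}_1(0,1)}<\infty$. Put $$\rho(u)=u^{\theta_1-\theta_0}\frac{a_0(u)\|b_0\|_{\widetilde{E}_0(0,u)}}{a_1(u)\|b_1\|_{\widetilde{E}_1(0,u)}},\qquad u>0.$$ Then, for every $f\in\overline{X}^{\mathcal R}_{\theta_0,b_0,E_0,a_0,F_0}+\overline{X}^{\mathcal R}_{\theta_1,b_1,E_1,a_1,F_1}$ and every $u>0$, $$\begin{aligned}K\big(\rho(u),f;\overline{X}^{\mathcal R}_{\theta_0,b_0,E_0,a_0,F_0},\overline{X}^{\mathcal R}_{\theta_1,b_1,E_1,a_1,F_1}\big)\sim{}&\Big\|b_0(t)\|s^{-\theta_0}a_0(s)K(s,f)\|_{\widetilde{F}_0(t,u)}\Big\|_{\widetilde{E}_0(0,u)}\\&+\rho(u)\,\|b_1\|_{\widetilde{E}_1(0,u)}\,\|t^{-\theta_1}a_1(t)K(t,f)\|_{\widetilde{F}_1(u,\infty)}\\&+\rho(u)\Big\|b_1(t)\|s^{-\theta_1}a_1(s)K(s,f)\|_{\widetilde{F}_1(t,\infty)}\Big\|_{\widetilde{E}_1(u,\infty)},\end{aligned}$$ with equivalence constants independent of $f$ and $u$.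
   Context: R.i. spaces: an ''r.i. space'' $E$ is a rearrangement invariant Banach function space on $(0,\infty)$ (Lebesgue measure) with the Fatou property. $\widetilde{E}$ denotes the corresponding r.i. space with respect to the measure $dt/t$ on $(0,\infty)$: if $E=\mathcal F(L_1,L_\infty)$ for an interpolation functor $\mathcal F$, then $\widetilde{E}=\mathcal F(\widetilde L_1,L_\infty)$ with $\widetilde L_1=L_1((0,\infty),dt/t)$; concretely $\|f\|_{\widetilde E}=\|f^\star\|_E$, where $f^\star$ is the non-increasing rearrangement of $f$ with respect to $dt/t$. For an interval $I\subset(0,\infty)$, $\|f\|_{\widetilde E(I)}=\|f\chi_I\|_{\widetilde E}$. Slowly varying functions: a positive (finite) measurable function $b$ on $(0,\infty)$ belongs to $SV$ if for every $\varepsilon>0$, $t^{\varepsilon}b(t)$ is equivalent to a non-decreasing function and $t^{-\varepsilon}b(t)$ is equivalent to a non-increasing function on $(0,\infty)$. For a compatible (quasi-)Banach couple $(Y_0,Y_1)$, $K(t,f;Y_0,Y_1)=\inf\{\|f_0\|_{Y_0}+t\|f_1\|_{Y_1}: f=f_0+f_1,\ f_i\in Y_i\}$; write $K(t,f)=K(t,f;X_0,X_1)$. The space $\overline X^{\mathcal R}_{\theta,b,E,a,F}$ consists of all $f\in X_0+X_1$ with finite (quasi-)norm $\big\|b(t)\|s^{-\theta}a(s)K(s,f)\|_{\widetilde F(t,\infty)}\big\|_{\widetilde E}$. In nested norms the inner norm is taken in $s$ and the outer one in $t$. $A\sim B$ means $A\le cB$ and $B\le cA$ for some constant $c>0$.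 *)

(* Defs.v *)
From HB Require Import structures.
From mathcomp Require Import all_boot all_order all_algebra.
From mathcomp Require Import all_classical all_reals all_analysis.
From mathcomp Require Import measurable_realfun.

Set Implicit Arguments.
Unset Strict Implicit.
Unset Printing Implicit Defensive.

Import Order.TTheory GRing.Theory Num.Theory.
Import numFieldNormedType.Exports.

Local Open Scope classical_set_scope.
Local Open Scope ring_scope.
Local Open Scope ereal_scope.

(** * Rearrangement invariant spaces on (0, oo) *)

(* Functions on (0, oo) are represented by functions on all of [R], whose
   values outside of the half-line are irrelevant. *)
Definition halfline (R : realType) : set R := `]0%R, +oo[.
Arguments halfline R : clear implicits.

Definition nneg_measurable (R : realType) (f : R -> \bar R) : Prop :=
  measurable_fun (halfline R) f /\ forall t : R, (0 < t)%R -> 0 <= f t.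

(* Banach function norms in the sense of Bennett and Sharpley: they are defined
   on nonnegative measurable functions with values in [0, +oo], and the norm of
   a general f is that of |f|; the Fatou property is one of the axioms. *)
Record ri_space (R : realType) := RISpace {
  ri_norm :> (R -> \bar R) -> \bar R;
  ri_norm_ge0 : forall f, nneg_measurable f -> 0 <= ri_norm f;
  ri_norm_eq0 : forall f, nneg_measurable f ->
    ri_norm f = 0 <->
    (\forall x \ae (@lebesgue_measure R), (0 < x)%R -> f x = 0);
  ri_normZ : forall (c : R) f, (0 <= c)%R -> nneg_measurable f ->
    ri_norm (fun x => c%:E * f x) = c%:E * ri_norm f;
  ri_normD : forall f g, nneg_measurable f -> nneg_measurable g ->
    ri_norm (fun x => f x + g x) <= ri_norm f + ri_norm g;
  ri_norm_le : forall f g, nneg_measurable f -> nneg_measurable g ->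
    (\forall x \ae (@lebesgue_measure R), (0 < x)%R -> f x <= g x) ->
    ri_norm f <= ri_norm g;
  ri_norm_fatou : forall (F : nat -> R -> \bar R) f,
    (forall n, nneg_measurable (F n)) -> nneg_measurable f ->
    (\forall x \ae (@lebesgue_measure R), (0 < x)%R ->
       nondecreasing_seq (fun n => F n x) /\ F n x @[n --> \oo] --> f x) ->
    ri_norm (F n) @[n --> \oo] --> ri_norm f;
  ri_norm_indic : forall A : set R, measurable A -> A `<=` halfline R ->
    lebesgue_measure A < +oo -> ri_norm (fun x => (\1_A x)%:E) < +oo;
  ri_norm_integral : forall A : set R, measurable A -> A `<=` halfline R ->
    lebesgue_measure A < +oo -> exists2 C : R, (0 < C)%R &
      forall f, nneg_measurable f ->
        \int[lebesgue_measure]_(x in A) f x <= C%:E * ri_norm f;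
  ri_norm_equimeasurable : forall f g,
    nneg_measurable f -> nneg_measurable g ->
    (forall l : R, (0 <= l)%R ->
       lebesgue_measure [set x | (0 < x)%R /\ l%:E < f x] =
       lebesgue_measure [set x | (0 < x)%R /\ l%:E < g x]) ->
    ri_norm f = ri_norm g
}.

(** * The spaces for the measure dt/t *)

Definition log_distribution (R : realType) (f : R -> \bar R) (l : R) : \bar R :=
  \int[lebesgue_measure]_(x in [set x | (0 < x)%R /\ l%:E < `|f x|]) (x^-1)%:E.

Definition log_rearrangement (R : realType) (f : R -> \bar R) (t : R) : \bar R :=
  ereal_inf [set l%:E | l in
    [set l : R | (0 <= l)%R /\ log_distribution f l <= t%:E]].

(* [tilde_norm E I f] is the norm of [f] in the space of functions on the
   interval [I] associated with [E] and the measure dt/t; the restriction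
   [f \_ I] is 0 outside of [I]. *)
Definition tilde_norm (R : realType) (E : ri_space R) (I : set R)
    (f : R -> \bar R) : \bar R :=
  E (log_rearrangement (f \_ I)).

(** * Slowly varying functions *)

Definition equiv_nondecreasing (R : realType) (h : R -> R) : Prop :=
  exists g : R -> R, exists c : R,
    [/\ (0 < c)%R,
        forall s t : R, (0 < s)%R -> (s <= t)%R -> (g s <= g t)%R &
        forall t : R, (0 < t)%R -> (h t <= c * g t)%R /\ (g t <= c * h t)%R].

Definition equiv_nonincreasing (R : realType) (h : R -> R) : Prop :=
  exists g : R -> R, exists c : R,
    [/\ (0 < c)%R,
        forall s t : R, (0 < s)%R -> (s <= t)%R -> (g t <= g s)%R &
        forall t : R, (0 < t)%R -> (h t <= c * g t)%R /\ (g t <= c * h t)%R].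

Definition slowly_varying (R : realType) (b : R -> R) : Prop :=
  [/\ measurable_fun (halfline R) b,
      forall t : R, (0 < t)%R -> (0 < b t)%R,
      forall e : R, (0 < e)%R -> equiv_nondecreasing (fun t => t `^ e * b t)%R &
      forall e : R, (0 < e)%R ->
        equiv_nonincreasing (fun t => t `^ (- e) * b t)%R].

(** * Quasi-Banach couples and the K-functional *)

(* A space is given by its set of elements in an ambient vector space and by
   its (quasi-)norm, which is only meaningful on that set. *)
Record qspace (R : realType) (V : lmodType R) := QSpace {
  qcarrier : set V;
  qnorm : V -> \bar R
}.

(* Banach spaces are the case C = 1 of the quasi-triangle inequality, and
   complex spaces are covered by restriction of scalars. *)
Record quasi_banach (R : realType) (V : lmodType R) (X : qspace V) : Prop :=
  QuasiBanach {
  qb0 : qcarrier X 0%R;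
  qbD : forall x y, qcarrier X x -> qcarrier X y -> qcarrier X (x + y)%R;
  qbZ : forall (c : R) x, qcarrier X x -> qcarrier X (c *: x)%R;
  qb_fin_num : forall x, qcarrier X x -> qnorm X x \is a fin_num;
  qb_norm_ge0 : forall x, qcarrier X x -> 0 <= qnorm X x;
  qb_norm_eq0 : forall x, qcarrier X x -> qnorm X x = 0 <-> x = 0%R;
  qb_normZ : forall (c : R) x, qcarrier X x ->
    qnorm X (c *: x)%R = `|c|%:E * qnorm X x;
  qb_normD : exists C : R, forall x y, qcarrier X x -> qcarrier X y ->
    qnorm X (x + y)%R <= C%:E * (qnorm X x + qnorm X y);
  qb_complete : forall v : nat -> V, (forall n, qcarrier X (v n)) ->
    (forall e : R, (0 < e)%R -> exists N : nat, forall m n : nat,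
       (N <= m)%N -> (N <= n)%N -> qnorm X (v m - v n)%R < e%:E) ->
    exists2 x, qcarrier X x & qnorm X (v n - x)%R @[n --> \oo] --> 0
}.

Definition continuously_embedded (R : realType) (V : topologicalLmodType R)
    (X : qspace V) : Prop :=
  forall U : set V, nbhs (0%R : V) U -> exists2 d : R, (0 < d)%R &
    forall x, qcarrier X x -> qnorm X x < d%:E -> U x.

Definition compatible_couple (R : realType) (V : topologicalLmodType R)
    (X0 X1 : qspace V) : Prop :=
  [/\ hausdorff_space V, quasi_banach X0, quasi_banach X1,
      continuously_embedded X0 & continuously_embedded X1].

Definition qsum (R : realType) (V : lmodType R) (Y0 Y1 : qspace V) : set V :=
  [set f | exists f0 f1, [/\ qcarrier Y0 f0, qcarrier Y1 f1 & f = (f0 + f1)%R]].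

Definition Kfun (R : realType) (V : lmodType R) (Y0 Y1 : qspace V)
    (t : R) (f : V) : \bar R :=
  ereal_inf [set z | exists f0 f1,
    [/\ qcarrier Y0 f0, qcarrier Y1 f1, f = (f0 + f1)%R &
        z = qnorm Y0 f0 + t%:E * qnorm Y1 f1]].

(** * The R-spaces *)

(* The norm of s |-> s^(-theta) a(s) K(s, f) in the space of functions on [I]
   associated with [F] and ds/s. *)
Definition K_norm (R : realType) (V : lmodType R) (X0 X1 : qspace V)
    (theta : R) (a : R -> R) (F : ri_space R) (I : set R) (f : V) : \bar R :=
  tilde_norm F I (fun s => (s `^ (- theta) * a s)%:E * Kfun X0 X1 s f).

Definition Rspace (R : realType) (V : lmodType R) (X0 X1 : qspace V)
    (theta : R) (b : R -> R) (E : ri_space R) (a : R -> R) (F : ri_space R) :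
    qspace V :=
  let N f := tilde_norm E (halfline R)
    (fun t => (b t)%:E * K_norm X0 X1 theta a F `]t, +oo[ f) in
  {| qcarrier := [set f | qsum X0 X1 f /\ N f < +oo]; qnorm := N |}.

(* Both norms are finite and positive for u > 0 in the intended use, where
   b0 and b1 are slowly varying with finite norms on (0, 1); [fine] then only
   turns them into real numbers. *)
Definition rho (R : realType) (theta0 theta1 : R) (a0 a1 b0 b1 : R -> R)
    (E0 E1 : ri_space R) (u : R) : R :=
  (u `^ (theta1 - theta0) *
    ((a0 u * fine (tilde_norm E0 `]0%R, u[ (EFin \o b0))) /
     (a1 u * fine (tilde_norm E1 `]0%R, u[ (EFin \o b1)))))%R.

(* Main.v *)
Require Import Defs.
From HB Require Import structures.
From mathcomp Require Import all_boot all_order all_algebra.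
From mathcomp Require Import all_classical all_reals all_analysis.
From mathcomp Require Import measurable_realfun ring lra.

Import Order.TTheory GRing.Theory Num.Theory.
Import numFieldNormedType.Exports.

Local Open Scope classical_set_scope.
Local Open Scope ring_scope.
Local Open Scope ereal_scope.

(** Fix u and write K(s, f) for K(s, f; X0, X1). The norm of f in an R-space cuts
    at u into three parts: a head, where both variables stay below u, a tail,
    where both stay above u, and a middle part, where the variables separate and
    which is the norm B(u) of b over (0, u) times the inner norm of K(., f) over
    (u, oo) ([nested_norm_le_parts]). The right-hand side of the theorem consists
    of the head for the first space and of rho(u) times the middle and the tail
    for the second space ([three_parts]).

    Upper bound. One decomposition serves both spaces, the one f = f0 + f1 that is
    optimal for K(u, f) up to a factor 2. Up to constants, K(s, f0) is at most
    K(s, f) for s <= u and at most K(u, f) for s >= u, while K(s, f1) is at most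
    (s/u) K(u, f) for s <= u and at most K(s, f) for s >= u. So the head of f0 and
    the middle and tail of f1 are controlled by those of f. The remaining parts
    only see the powers s^0 and s^1, with 0 < theta0 and theta1 < 1, and amount to
    u^(-theta_i) a_i(u) B_i(u) K(u, f). The function rho is the ratio that makes the
    two remainders agree ([rho_balance]), and since K(., f) increases they are
    dominated by the middle part ([weighted_norm_ge_value]).

    Lower bound. The three parts are quasi-subadditive in f, so they can be
    estimated for f0 in the first space and f1 in the second separately. The parts
    that belong to the same space as f_i are pieces of its norm. For the others,
    monotonicity of K gives K(s, f_i) <= C |f_i| s^theta_i / (a_i(s) B_i(s))
    ([nested_norm_ge_value]), and the parts of such a power times a slow function
    are explicit because theta0 < theta1 ([head_of_power], [middle_of_power],
    [tail_of_power]).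

    All evaluations of norms rest on the dilation invariance of dt/t. In the
    distance |ln s - ln t| a slowly varying function grows more slowly than any
    exponential, so a nonzero power times such a function decays exponentially
    away from t on one side, and exponential decay has a norm that does not depend
    on t ([tilde_norm_decay]). Conversely an interval of logarithmic length 1
    already sees the value at t ([tilde_norm_bump]). Finally, the norm for dt/t is
    defined by a rearrangement, which is not subadditive; the norm axioms
    are recovered by composing with the exponential and with a measure preserving
    map from the half-line to the line ([tilde_normE]). *)

Set Implicit Arguments.
Unset Strict Implicit.
Unset Printing Implicit Defensive.

(** * The measure dx/x in the logarithmic variable *)

Section LogMeasure.
Variable R : realType.
Local Notation mu := (@lebesgue_measure R).
Implicit Types (A B : set R) (f : R -> \bar R).

Lemma measurable_halfline : measurable (halfline R).
Proof. exact: measurable_itv. Qed.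

Lemma halflineE (x : R) : halfline R x = (0 < x)%R :> Prop.
Proof. by rewrite /halfline/= in_itv/= andbT. Qed.

Lemma measurable_translation (c : R) :
  measurable_fun [set: R] (fun x : R => (x + c)%R).
Proof. exact: measurable_funD. Qed.

Lemma lebesgue_measure_translation (c : R) A : measurable A ->
  mu ((fun x => x + c)%R @^-1` A) = mu A.
Proof.
move=> mA; have mT := measurable_translation c.
pose T : _ -> measurableTypeR R := fun x : R => (x + c)%R.
rewrite -[LHS]/(pushforward mu T A).
apply/esym/lebesgue_measure_unique => //= _ [[a b] _ <-].
rewrite /pushforward /=.
have -> : (fun x => (x + c)%R) @^-1` `]a, b] = `](a - c)%R, (b - c)%R]%classic.
  by apply/seteqP; split=> x /=; rewrite !in_itv/= => /andP[? ?];
     apply/andP; split; lra.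
rewrite !lebesgue_measure_itv/= !lte_fin ltrD2r.
by case: ifP => // _; rewrite -!EFinD; congr EFin; lra.
Qed.

(** The image of dx/x under the logarithm; it is shown to be Lebesgue measure by
    evaluating it on intervals. *)
Definition log_image (B : set (measurableTypeR R)) : \bar R :=
  \int[mu]_(x in halfline R `&` (@ln R) @^-1` B) (x^-1)%:E.

Let measurable_log_preimage (B : set (measurableTypeR R)) : measurable B ->
  measurable (halfline R `&` (@ln R) @^-1` B).
Proof.
move=> mB; apply: (measurable_funS _ _ (@measurable_ln R)) => //.
exact: measurable_halfline.
Qed.

Let measurable_inv_halfline : measurable_fun (halfline R) (fun x : R => (x^-1)%:E).
Proof.
apply/measurable_EFinP.
apply: open_continuous_measurable_fun; first exact: interval_open.
move=> x /set_mem; rewrite halflineE => x0.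
by apply: inv_continuous; rewrite gt_eqF.
Qed.

Let inv_halfline_ge0 (x : R) : halfline R x -> 0 <= (x^-1)%:E.
Proof. by rewrite halflineE lee_fin invr_ge0 => /ltW. Qed.

Let log_image0 : log_image set0 = 0.
Proof. by rewrite /log_image preimage_set0 setI0 integral_set0. Qed.

Let log_image_ge0 B : 0 <= log_image B.
Proof. by apply: integral_ge0 => x [/inv_halfline_ge0]. Qed.

Let log_image_sigma_additive : semi_sigma_additive log_image.
Proof.
move=> F mF tF mUF; rewrite /log_image preimage_bigcup setI_bigcupr.
rewrite ge0_integral_bigcup//=.
- by apply: is_cvg_nneseries => n _ _; exact: log_image_ge0.
- by move=> k; have := measurable_log_preimage (mF k).
- apply: measurable_funS measurable_inv_halfline.
    exact: measurable_halfline.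
  by move=> x [k _ []].
- by move=> x [k _ [/inv_halfline_ge0]].
- apply/trivIsetP => i j _ _ ij; rewrite setIACA -(preimage_setI (@ln R)).
  by move/trivIsetP : tF => /(_ i j I I ij) ->; rewrite preimage_set0 setI0.
Qed.

HB.instance Definition _ := isMeasure.Build _ (measurableTypeR R) R log_image
  log_image0 log_image_ge0 log_image_sigma_additive.

Let log_image_itv (a b : R) : (a < b)%R -> log_image `]a, b] = (b - a)%:E.
Proof.
move=> ab; rewrite /log_image.
have -> : halfline R `&` (@ln R) @^-1` `]a, b] = `](expR a), (expR b)]%classic.
  apply/seteqP; split=> x /=.
    rewrite halflineE in_itv/= => -[x0 /andP[ax xb]].
    rewrite in_itv/=.
    by rewrite -(lnK (_ : x \is Num.pos)) ?posrE// ltr_expR ax ler_expR xb.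
  rewrite halflineE !in_itv/= => /andP[ax xb].
  have x0 : (0 < x)%R := lt_trans (expR_gt0 a) ax.
  rewrite x0; split=> //; move: ax xb.
  by rewrite -{1 2}(lnK (_ : x \is Num.pos)) ?posrE// ltr_expR ler_expR => -> ->.
have gt0 x : (expR a <= x)%R -> (0 < x)%R by exact: lt_le_trans (expR_gt0 a).
rewrite integral_itv_obnd_cbnd; last first.
  apply: measurable_funS measurable_inv_halfline => //.
    exact: measurable_halfline.
  by move=> x; rewrite halflineE/= in_itv/= => /andP[/ltW/gt0].
rewrite (@continuous_FTC2 _ _ (@ln R)).
- by rewrite !expRK.
- by rewrite ltr_expR.
- apply: continuous_in_subspaceT => x /set_mem /=; rewrite in_itv/= => /andP[/gt0 x0 _].
  by apply: inv_continuous; rewrite gt_eqF.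
- split.
  + move=> x; rewrite in_itv/= => /andP[/ltW/gt0 x0 _].
    by apply: ex_derive; exact: is_derive1_ln.
  + by apply: cvg_at_right_filter; apply: continuous_ln; exact: expR_gt0.
  + by apply: cvg_at_left_filter; apply: continuous_ln; exact: expR_gt0.
- move=> x; rewrite in_itv/= => /andP[/ltW/gt0 x0 _].
  by rewrite derive1E; have [_ ->] := is_derive1_ln x0.
Qed.

Lemma log_imageE B : measurable B -> log_image B = mu B.
Proof.
move=> mB; apply/esym.
apply: (@lebesgue_measure_unique R log_image) => //= _ [[a b] _ <-].
rewrite lebesgue_measure_itv/= lte_fin; case: ltP => ab; first by rewrite log_image_itv.
by rewrite set_itv_ge ?measure0// bnd_simp -leNgt.
Qed.

(** The substitution x = e^y turns dx/x into dy, so that in the variable ln x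
    dilations become translations. *)
Lemma integral_dlog A : measurable A -> A `<=` halfline R ->
  \int[mu]_(x in A) (x^-1)%:E = mu (@expR R @^-1` A).
Proof.
move=> mA A0.
have mE : measurable (@expR R @^-1` A).
  by rewrite -[X in measurable X]setTI; exact: measurable_expR.
rewrite -log_imageE// /log_image; congr (integral _ _ _).
apply/seteqP; split=> x.
  move=> Ax; have := A0 _ Ax; rewrite halflineE => x0.
  have hx : halfline R x by rewrite halflineE.
  by split=> //; rewrite /= lnK ?posrE.
by move=> []; rewrite halflineE => x0 /=; rewrite lnK ?posrE.
Qed.

End LogMeasure.
Arguments measurable_halfline R : clear implicits.

(** * A measure preserving map from the half-line to the line *)

(** An enumeration of the integers, used to number the unit intervals of the
    line: 0, -1, 1, -2, 2, and so on. *)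
Definition cell (k : nat) : int := if odd k then Negz k./2 else Posz k./2.

Lemma cell_inj : injective cell.
Proof.
move=> i j; rewrite /cell.
case: ifP => oi; case: ifP => oj // [] hij.
- by rewrite -(odd_double_half i) -(odd_double_half j) oi oj hij.
- by rewrite -(odd_double_half i) -(odd_double_half j) oi oj hij.
Qed.

Lemma cell_surj (z : int) : exists k, cell k = z.
Proof.
case: z => n; first by exists n.*2; rewrite /cell odd_double doubleK.
by exists n.*2.+1; rewrite /cell /= odd_double /= uphalf_double.
Qed.

Section Unroll.
Variable R : realType.
Local Notation mu := (@lebesgue_measure R).
Implicit Types (A B : set R) (f : R -> \bar R).

(** The k-th unit interval of the half-line is translated onto the unit interval
    of the line that starts at [cell k]. *)
Definition unroll (x : R) : R :=
  (x - (Num.truncn x)%:R + (cell (Num.truncn x))%:~R)%R.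

Let step (k : nat) : set R := `[k%:R, k.+1%:R[.

Let image_step (k : nat) : set R := `[(cell k)%:~R, (cell k + 1)%:~R[.

Let unroll_step k B :
  step k `&` unroll @^-1` B =
  (fun x : R => x + ((cell k)%:~R - k%:R))%R @^-1` (image_step k `&` B).
Proof.
have E x : step k x -> unroll x = (x + ((cell k)%:~R - k%:R))%R.
  rewrite /step/= in_itv/= => xk; rewrite /unroll (truncn_def xk); lra.
have S x : step k x <-> image_step k (x + ((cell k)%:~R - k%:R))%R.
  rewrite /step/image_step/= !in_itv/= intrD -[k.+1]addn1 natrD.
  split=> /andP[? ?]; apply/andP; split; lra.
apply/seteqP; split=> x.
  by move=> [sx /= Bx]; rewrite /preimage/= -E//; split=> //; rewrite E//; apply/S.
by move=> [/S sx Bx]; split=> //=; rewrite E.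
Qed.

Let bigcup_step : \bigcup_k step k = [set x | (0 <= x)%R].
Proof.
apply/seteqP; split=> [x [k _]|x /= x0].
  by rewrite /step/= in_itv/= => /andP[+ _]; apply: le_trans.
by exists (Num.truncn x) => //; rewrite /step/= in_itv/= truncn_itv.
Qed.

Let bigcup_image_step : \bigcup_k image_step k = [set: R].
Proof.
apply/seteqP; split=> // x _; have [k kx] := cell_surj (Num.floor x).
by exists k => //; rewrite /image_step/= in_itv/= kx floor_itv.
Qed.

Let trivIset_image_step : trivIset [set: nat] image_step.
Proof.
move=> i j _ _ [x [/=]]; rewrite /image_step/= !in_itv/= => /floor_def xi /floor_def xj.
by apply: cell_inj; rewrite -xi xj.
Qed.

Let trivIset_step : trivIset [set: nat] step.
Proof.
move=> i j _ _ [x [/=]]; rewrite /step/= !in_itv/= => /truncn_def xi /truncn_def xj.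
by rewrite -xi.
Qed.

Let measurable_unroll_step k B : measurable B ->
  measurable (step k `&` unroll @^-1` B).
Proof.
move=> mB; rewrite unroll_step -[X in measurable X]setTI.
apply: measurable_translation => //; apply: measurableI => //.
exact: measurable_itv.
Qed.

Let nonneg_unroll B : [set x | (0 <= x)%R] `&` unroll @^-1` B =
  \bigcup_k (step k `&` unroll @^-1` B).
Proof. by rewrite -bigcup_step setI_bigcupl. Qed.

Lemma measurable_unroll : measurable_fun [set x : R | (0 <= x)%R] unroll.
Proof.
move=> _ B mB; rewrite nonneg_unroll.
by apply: bigcupT_measurable => k; exact: measurable_unroll_step.
Qed.

(** Translations preserve Lebesgue measure and the images of the unit intervals
    tile the line. *)
Lemma unroll_measure_preserving B : measurable B ->
  mu (halfline R `&` unroll @^-1` B) = mu B.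
Proof.
move=> mB.
have mi k : measurable (image_step k `&` B).
  by apply: measurableI => //; exact: measurable_itv.
(* The unit intervals are closed on the left, so the origin has to be added. *)
transitivity (mu ([set x | (0 <= x)%R] `&` unroll @^-1` B)).
  have mH : measurable (halfline R `&` unroll @^-1` B).
    have -> : halfline R `&` unroll @^-1` B =
        halfline R `&` ([set x | (0 <= x)%R] `&` unroll @^-1` B).
      rewrite setIA; congr (_ `&` _); apply/seteqP; split=> [x|x []//].
      by rewrite halflineE => x0; split=> /=; [rewrite halflineE|exact: ltW].
    apply: measurableI; first exact: measurable_halfline.
    by rewrite nonneg_unroll; apply: bigcupT_measurable => k;
       exact: measurable_unroll_step.
  have m0 : measurable ([set 0%R] `&` unroll @^-1` B).
    have [B0|B0] := pselect (B (unroll 0%R)).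
      suff -> : [set 0%R] `&` unroll @^-1` B = [set 0%R] by exact: measurable_set1.
      by apply/seteqP; split=> [x []//|x ->]; split.
    suff -> : [set 0%R] `&` unroll @^-1` B = set0 by exact: measurable0.
    by apply/seteqP; split=> // x [/= ->].
  have n0 : mu ([set 0%R] `&` unroll @^-1` B) = 0.
    have := @subset_measure0 _ _ _ mu _ [set 0%R] m0 (measurable_set1 _).
    by apply; [exact: subIsetl|exact: lebesgue_measure_set1].
  rewrite -[LHS](@measureU0 _ (measurableTypeR R) _ mu _ _ mH m0 n0) -setIUl; congr (mu (_ `&` _)).
  apply/seteqP; split=> x /=.
    by move=> [|->//]; rewrite halflineE => /ltW.
  by rewrite le_eqVlt => /predU1P[<-|x0]; [right|left; rewrite halflineE].
rewrite nonneg_unroll measure_semi_bigcup; first last.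
- by apply: bigcupT_measurable => k; exact: measurable_unroll_step.
- by apply: trivIset_setIr; exact: trivIset_step.
- by move=> k; exact: measurable_unroll_step.
rewrite -[in RHS](setTI B) -bigcup_image_step setI_bigcupl measure_semi_bigcup.
- apply: eq_eseriesr => k _; rewrite unroll_step.
  exact: (lebesgue_measure_translation _ (mi k)).
- exact: mi.
- by apply: trivIset_setIr; exact: trivIset_image_step.
- exact: bigcupT_measurable.
Qed.

(** The enumeration goes to infinity in both directions at speed 1/2; this is
    what turns exponential decay on the line into exponential decay on the
    half-line. *)
Lemma unroll_growth (x : R) : (0 < x)%R -> (x / 2 - 1 <= `|unroll x|)%R.
Proof.
move=> x0; have := truncn_itv (ltW x0); rewrite /unroll /cell.
set k := Num.truncn x => /andP[]; rewrite -natr1.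
have j0 : (0 <= k./2%:R :> R)%R by [].
have -> : (k%:R = (odd k)%:R + k./2%:R * 2 :> R)%R.
  by rewrite -{1}(odd_double_half k) natrD -muln2 natrM.
case: (odd k) => /= h1 h2.
  have -> : ((Negz k./2)%:~R = - (k./2%:R + 1) :> R)%R.
    by rewrite NegzE mulrNz -pmulrn natr1.
  rewrite ler0_norm; lra.
rewrite ger0_norm -pmulrn; lra.
Qed.

End Unroll.

(** * Rearrangements for dt/t *)

Lemma cvge_le_bound (R : realType) (u : (\bar R)^nat) (l x : \bar R) :
  u n @[n --> \oo] --> l -> (forall n, u n <= x) -> l <= x.
Proof.
move=> ul ux; rewrite -(cvg_lim _ ul)//.
by apply: lime_le; [apply/cvg_ex; exists l|exact: nearW].
Qed.

Section Representation.
Variable R : realType.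
Local Notation mu := (@lebesgue_measure R).
Implicit Types (A B I : set R) (f g : R -> \bar R).

Lemma nonincreasing_nneg_measurable f :
  (forall t, (0 < t)%R -> 0 <= f t) ->
  (forall s t, (0 < s)%R -> (s <= t)%R -> f t <= f s) -> nneg_measurable f.
Proof.
move=> f0 df; split=> //.
apply: (measurability (@ErealGenCInfty.G R)); first exact: ErealGenCInfty.measurableE.
move=> _ [_ [r ->] <-]; apply: is_interval_measurable => s t /=.
rewrite !halflineE !in_itv/= !andbT => -[s0 fs] [t0 ft] u /andP[su ut].
have u0 : (0 < u)%R by exact: lt_le_trans su.
by rewrite halflineE in_itv/= andbT; split=> //; exact: le_trans ft (df _ _ u0 ut).
Qed.

Lemma nondecreasing_nneg_measurable f :
  (forall t, (0 < t)%R -> 0 <= f t) ->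
  (forall s t, (0 < s)%R -> (s <= t)%R -> f s <= f t) -> nneg_measurable f.
Proof.
move=> f0 df; split=> //.
apply: (measurability (@ErealGenCInfty.G R)); first exact: ErealGenCInfty.measurableE.
move=> _ [_ [r ->] <-]; apply: is_interval_measurable => s t /=.
rewrite !halflineE !in_itv/= !andbT => -[s0 fs] [t0 ft] u /andP[su ut].
have u0 : (0 < u)%R by exact: lt_le_trans su.
by rewrite halflineE in_itv/= andbT; split=> //; exact: le_trans fs (df _ _ s0 su).
Qed.

(** A function on the half-line with Lebesgue measure whose distribution is that
    of [f] for dt/t. Unlike the rearrangement it is linear in [f], and this is
    how the norm axioms of [E] are transported to dt/t. *)
Definition unrolled f : R -> \bar R := f \o @expR R \o @unroll R.

Lemma measurable_comp_expR f : measurable_fun (halfline R) f ->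
  measurable_fun [set: R] (f \o @expR R).
Proof.
have h : [set expR x | x in [set: R]] `<=` halfline R.
  by move=> _ [x _ <-]; rewrite halflineE expR_gt0.
by move=> mf; exact: (measurable_comp (measurable_halfline R) h mf (@measurable_expR R)).
Qed.

Lemma unrolled_nneg_measurable f : nneg_measurable f ->
  nneg_measurable (unrolled f).
Proof.
move=> [mf f0]; split; last by move=> t _; apply: f0; exact: expR_gt0.
apply: (measurable_comp (F := [set: R])) => //; first exact: measurable_comp_expR.
apply: measurable_funS (@measurable_unroll R); last first.
  by move=> x; rewrite halflineE => /ltW.
rewrite (_ : [set x | _] = `[0%R, +oo[%classic); first exact: measurable_itv.
by apply/seteqP; split=> x; rewrite /= in_itv/= andbT.
Qed.

Let superlevel f (l : R) : set R := [set y | l%:E < f (expR y)].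

Let measurable_superlevel f l : nneg_measurable f -> measurable (superlevel f l).
Proof.
move=> [mf f0]; rewrite -[X in measurable X]setTI.
exact: (@emeasurable_fun_o_infty _ _ _ _ (f \o @expR R) measurableT
  (measurable_comp_expR mf) l%:E).
Qed.

Lemma unrolled_distribution f (l : R) : nneg_measurable f ->
  mu [set x | (0 < x)%R /\ l%:E < unrolled f x] = mu (superlevel f l).
Proof.
move=> nf; rewrite -(unroll_measure_preserving (measurable_superlevel l nf)).
by congr (mu _); apply/seteqP; split=> x []; rewrite /= -halflineE.
Qed.

Lemma log_distributionE f (l : R) : nneg_measurable f ->
  log_distribution f l = mu (superlevel f l).
Proof.
move=> [mf f0]; rewrite /log_distribution.
rewrite (_ : [set x | _] = halfline R `&` [set x | l%:E < f x]); last first.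
  apply/seteqP; split=> x []; rewrite ?halflineE/= => x0; rewrite gee0_abs ?f0//.
  by split=> //; rewrite halflineE.
rewrite integral_dlog; last by move=> x [].
  congr (mu _); apply/seteqP; split=> x /=.
    by case.
  by split=> //; rewrite halflineE expR_gt0.
exact: emeasurable_fun_o_infty (measurable_halfline R) mf _.
Qed.

Lemma log_rearrangement_nneg_measurable f : nneg_measurable (log_rearrangement f).
Proof.
apply: nonincreasing_nneg_measurable => [t _|s t _ st].
  by apply: le_ereal_inf_tmp => _ [l [l0 _] <-]; rewrite lee_fin.
apply: ereal_inf_le_tmp => _ [l [l0 ls] <-]; exists l => //; split=> //.
by rewrite (le_trans ls)// lee_fin.
Qed.

(** The distribution function is right-continuous, by continuity of the measure
    along increasing unions, hence the rearrangement is its exact inverse. *)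
Lemma lt_log_rearrangement f (l x : R) : nneg_measurable f -> (0 <= l)%R ->
  (l%:E < log_rearrangement f x) = (x%:E < log_distribution f l).
Proof.
move=> nf l0; apply/idP/idP; rewrite !ltNge; apply: contra => h.
  by apply: ereal_inf_lbound; exists l.
(* The infimum is at most l, so some level below l + 1/(n+1) is admissible; then
   let n grow. *)
have key (n : nat) : mu (superlevel f (l + n.+1%:R^-1)) <= x%:E.
  have : log_rearrangement f x < (l + n.+1%:R^-1)%:E.
    by rewrite (le_lt_trans h)// lte_fin ltrDl invr_gt0.
  move=> /ereal_inf_lt [_ [l' [l'0 l'x] <-]]; rewrite lte_fin => /ltW l'l.
  apply: le_trans l'x; rewrite log_distributionE//.
  apply: le_measure; rewrite ?inE; [exact: measurable_superlevel..|].
  by move=> y /=; apply: le_lt_trans; rewrite lee_fin.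
have cvgl : mu (superlevel f (l + n.+1%:R^-1)) @[n --> \oo] --> mu (superlevel f l).
  have -> : superlevel f l = \bigcup_n superlevel f (l + n.+1%:R^-1).
    rewrite /superlevel; apply/seteqP; split=> y /=; last first.
      by move=> [n _] /=; apply: lt_trans; rewrite lte_fin ltrDl invr_gt0.
    move=> ly; have [r lr ry] : exists2 r : R, (l < r)%R & r%:E <= f (expR y).
      move: ly; case: (f (expR y)) => [r|_|//].
        by rewrite lte_fin => lr; exists r.
      by exists (l + 1)%R; rewrite ?leey// ltrDl.
    have /ltr_add_invr [n nr] := lr.
    by exists n => //=; apply: lt_le_trans ry; rewrite lte_fin.
  apply: nondecreasing_cvg_mu.
  - by move=> n; exact: measurable_superlevel.
  - by apply: bigcupT_measurable => n; exact: measurable_superlevel.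
  - move=> m n mn; apply/subsetPset => y; rewrite /superlevel/=; apply: le_lt_trans.
    by rewrite lee_fin lerD2l lef_pV2 ?posrE// ler_nat.
rewrite log_distributionE//.
exact: (cvge_le_bound cvgl).
Qed.

(** The rearrangement and [unrolled f] are equimeasurable, so rearrangement
    invariance identifies their norms. *)
Lemma log_rearrangement_unrolled (E : ri_space R) f : nneg_measurable f ->
  E (log_rearrangement f) = E (unrolled f).
Proof.
move=> nf; apply: ri_norm_equimeasurable.
- exact: log_rearrangement_nneg_measurable.
- exact: unrolled_nneg_measurable.
move=> l l0; rewrite unrolled_distribution// -log_distributionE//.
rewrite (_ : [set x | _] = [set x | (0 < x)%R /\ x%:E < log_distribution f l]); last first.
  by apply/seteqP; split=> x /= []; rewrite lt_log_rearrangement.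
have D0 : 0 <= log_distribution f l by rewrite log_distributionE.
case: (log_distribution f l) D0 => [d d0|_|//].
- rewrite (_ : [set x | _] = `]0%R, d[%classic).
    rewrite lebesgue_measure_itv/= lte_fin.
    case: ltP => [_|dl]; first by rewrite oppr0 adde0.
    by congr EFin; apply/le_anti; rewrite dl -lee_fin d0.
  by apply/seteqP; split=> x /=; rewrite in_itv/= lte_fin; [move=> [-> ->]|move=> /andP[-> ->]].
- rewrite (_ : [set x | _] = `]0%R, +oo[%classic).
    by rewrite lebesgue_measure_itv/= ltry.
  by apply/seteqP; split=> x /=; rewrite in_itv/= ltry andbT; [case|].
Qed.

Lemma nneg_measurable_restrict f I : nneg_measurable f -> measurable I ->
  nneg_measurable (f \_ I).
Proof.
move=> [mf f0] mI; split.
  apply/measurable_restrict => //; first exact: measurable_halfline.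
  by apply: measurable_funS mf => //; exact: measurable_halfline.
by move=> t t0; rewrite patchE; case: ifP => // _; exact: f0.
Qed.

Lemma tilde_normE (E : ri_space R) I f : nneg_measurable f -> measurable I ->
  tilde_norm E I f = E (unrolled (f \_ I)).
Proof.
move=> nf mI.
exact: log_rearrangement_unrolled (nneg_measurable_restrict nf mI).
Qed.

End Representation.

(** * Norm properties for dt/t *)

Section TildeNorm.
Variables (R : realType) (E : ri_space R).
Local Notation mu := (@lebesgue_measure R).
Implicit Types (I J : set R) (f g : R -> \bar R).

Lemma nneg_measurableD f g : nneg_measurable f -> nneg_measurable g ->
  nneg_measurable (fun x => f x + g x).
Proof.
move=> [mf f0] [mg g0]; split; first exact: emeasurable_funD.
by move=> t t0; rewrite adde_ge0 ?f0 ?g0.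
Qed.

Lemma nneg_measurableM f g : nneg_measurable f -> nneg_measurable g ->
  nneg_measurable (fun x => f x * g x).
Proof.
move=> [mf f0] [mg g0]; split; first exact: emeasurable_funM.
by move=> t t0; rewrite mule_ge0 ?f0 ?g0.
Qed.

Lemma nneg_measurable_cst (c : \bar R) : 0 <= c -> nneg_measurable (fun _ : R => c).
Proof. by move=> c0; split=> //; exact: measurable_cst. Qed.

Lemma nneg_measurable_EFin (b : R -> R) : measurable_fun (halfline R) b ->
  (forall t, (0 < t)%R -> (0 <= b t)%R) -> nneg_measurable (EFin \o b).
Proof.
move=> mb b0; split; first exact/measurable_EFinP.
by move=> t t0; rewrite lee_fin b0.
Qed.

Let nneg_unrolled_restrict f I : nneg_measurable f -> measurable I ->
  nneg_measurable (unrolled (f \_ I)).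
Proof.
by move=> nf mI; apply/unrolled_nneg_measurable/nneg_measurable_restrict.
Qed.

Lemma ri_norm_le_pointwise f g : nneg_measurable f -> nneg_measurable g ->
  (forall x, (0 < x)%R -> f x <= g x) -> E f <= E g.
Proof.
by move=> nf ng fg; apply: ri_norm_le => //; apply: aeW => x /=; exact: fg.
Qed.

Lemma tilde_norm_ge0 I f : nneg_measurable f -> measurable I ->
  0 <= tilde_norm E I f.
Proof.
by move=> nf mI; rewrite tilde_normE//; apply: ri_norm_ge0;
  exact: nneg_unrolled_restrict.
Qed.

Lemma tilde_norm_le I J f g : nneg_measurable f -> nneg_measurable g ->
  measurable I -> measurable J ->
  (forall t, (0 < t)%R -> I t -> J t /\ f t <= g t) ->
  tilde_norm E I f <= tilde_norm E J g.
Proof.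
move=> nf ng mI mJ fg; rewrite !tilde_normE//.
apply: ri_norm_le_pointwise; [exact: nneg_unrolled_restrict..|].
move=> x _; rewrite /unrolled /= !patchE.
set t := expR _; have t0 : (0 < t)%R := expR_gt0 _.
case: ifPn => [/set_mem/(fg _ t0)[Jt fgt]|_]; first by rewrite mem_set.
by case: ifP => // _; case: ng => _ /(_ _ t0).
Qed.

Lemma tilde_normD I f g : nneg_measurable f -> nneg_measurable g ->
  measurable I ->
  tilde_norm E I (fun t => f t + g t) <= tilde_norm E I f + tilde_norm E I g.
Proof.
move=> nf ng mI; rewrite !tilde_normE//; last exact: nneg_measurableD.
apply: le_trans (ri_normD _ (nneg_unrolled_restrict nf mI)
  (nneg_unrolled_restrict ng mI)).
have nfg := nneg_measurableD nf ng.
apply: ri_norm_le_pointwise.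
- exact: nneg_unrolled_restrict.
- by apply: nneg_measurableD; exact: nneg_unrolled_restrict.
- by move=> x _; rewrite /unrolled /= !patchE; case: ifP; rewrite ?adde0.
Qed.

Lemma tilde_normZ (c : R) I f : (0 <= c)%R -> nneg_measurable f ->
  measurable I -> tilde_norm E I (fun t => c%:E * f t) = c%:E * tilde_norm E I f.
Proof.
move=> c0 nf mI; rewrite !tilde_normE//; last first.
  by apply: nneg_measurableM => //; apply: nneg_measurable_cst; rewrite lee_fin.
rewrite -(ri_normZ _ c0)//; last exact: nneg_unrolled_restrict.
congr (ri_norm E _); apply/funext => x.
by rewrite /unrolled /= !patchE; case: ifP; rewrite ?mule0.
Qed.

Lemma tilde_normU I J f : nneg_measurable f -> measurable I -> measurable J ->
  tilde_norm E (I `|` J) f <= tilde_norm E I f + tilde_norm E J f.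
Proof.
move=> nf mI mJ; have mIJ := measurableU _ _ mI mJ; rewrite !tilde_normE//.
apply: le_trans (ri_normD _ (nneg_unrolled_restrict nf mI)
  (nneg_unrolled_restrict nf mJ)).
apply: ri_norm_le_pointwise.
- exact: nneg_unrolled_restrict.
- by apply: nneg_measurableD; exact: nneg_unrolled_restrict.
- move=> x _; rewrite /unrolled /= !patchE in_setU.
  set t := expR _; have f0 : 0 <= f t by case: nf => _; apply; exact: expR_gt0.
  by case: (t \in I); case: (t \in J) => /=; rewrite ?adde0 ?add0e ?leeDl.
Qed.

Lemma tilde_norm_set1 (u : R) f : nneg_measurable f -> tilde_norm E [set u] f = 0.
Proof.
move=> nf; rewrite /tilde_norm.
apply/(ri_norm_eq0 E (log_rearrangement_nneg_measurable _)).
apply: aeW => t /= t0; apply/le_anti/andP; split; last first.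
  by apply: le_ereal_inf_tmp => _ [l [l0 _] <-]; rewrite lee_fin.
apply: ereal_inf_lbound; exists 0%R => //; split=> //.
rewrite /log_distribution (@integral_Sset1 _ _ _ u) ?lee_fin ?ltW//.
move=> x /= [_]; rewrite patchE; case: ifPn => [/set_mem//|_].
by rewrite abse0 ltxx.
Qed.

(** For an infinite constant, compare with its integer approximations. *)
Lemma tilde_norm_mule_ge (M : \bar R) I f : 0 <= M -> nneg_measurable f ->
  measurable I -> M * tilde_norm E I f <= tilde_norm E I (fun t => M * f t).
Proof.
case: M => [c|_|//]; first by rewrite lee_fin => c0 nf mI; rewrite tilde_normZ.
move=> nf mI; have T0 := tilde_norm_ge0 nf mI.
have nM : nneg_measurable (fun t => +oo * f t).
  by apply: nneg_measurableM => //; exact: nneg_measurable_cst.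
have [->|Tn0] := eqVneq (tilde_norm E I f) 0.
  by rewrite mule0; exact: tilde_norm_ge0.
have Tgt0 : 0 < tilde_norm E I f by rewrite lt_neqAle eq_sym Tn0.
rewrite (gt0_mulye Tgt0) leye_eq; apply/eqP.
have step (n : nat) : n%:R%:E * tilde_norm E I f <= tilde_norm E I (fun t => +oo * f t).
  have nN : nneg_measurable (fun t => n%:R%:E * f t).
    apply: (nneg_measurableM _ nf); apply: nneg_measurable_cst.
    by rewrite lee_fin.
  rewrite -(tilde_normZ (ler0n _ n) nf mI).
  apply: (tilde_norm_le nN nM mI mI) => t t0 It; split=> //.
  have f0 : 0 <= f t by case: nf => _; apply.
  by rewrite lee_wpmul2r// leey.
case: (tilde_norm E I f) Tgt0 step => [r r0|_|//] step; last first.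
  by have := step 1%N; rewrite mul1e leye_eq => /eqP.
apply: contrapT => /eqP; rewrite -ltey => h.
have := tilde_norm_ge0 nM mI; move: h step.
case: (tilde_norm E I _) => // z _ step z0.
have := step (Num.truncn (z / r)).+1.
rewrite -EFinM lee_fin leNgt -ltr_pdivrMr ?truncnS_gt//.
Qed.

End TildeNorm.

(** * Dilation invariance and decay *)

Section Calibration.
Variables (R : realType) (E : ri_space R).
Local Notation mu := (@lebesgue_measure R).
Implicit Types (I J : set R) (f g : R -> \bar R).

Lemma nneg_measurable_indic (A : set R) : measurable A ->
  nneg_measurable (fun x => (\1_A x)%:E).
Proof.
move=> mA; apply: nneg_measurable_EFin => [|t _]; last by rewrite indicE.
exact: measurable_indic.
Qed.

Lemma indic_superlevel (A : set R) (l : R) : (0 <= l)%R -> A `<=` halfline R ->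
  [set x | (0 < x)%R /\ l%:E < (\1_A x)%:E] = if (l < 1)%R then A else set0.
Proof.
move=> l0 A0; case: ltP => l1; apply/seteqP; split=> x //=.
- rewrite indicE; case: (boolP (x \in A)) => [/set_mem//|_ [_]].
  by rewrite lte_fin ltNge l0.
- by move=> Ax; move: (A0 _ Ax); rewrite halflineE indicE (mem_set Ax) lte_fin.
- by rewrite lte_fin indicE => -[_]; case: (x \in A) => /=; rewrite ltNge ?l0 ?l1.
Qed.

Lemma sub_halfline (a b : R) : (0 <= a)%R -> `]a, b[ `<=` halfline R.
Proof.
by move=> a0 x; rewrite halflineE/= in_itv/= => /andP[+ _]; exact: le_lt_trans.
Qed.

(** The axioms make the norm of this indicator function finite, and positive
    because the interval is not negligible. It serves as the unit of length. *)
Lemma ri_norm_unit_interval : exists2 K : R, (0 < K)%R &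
  E (fun x => (\1_(`]0%R, 1%R[) x)%:E) = K%:E.
Proof.
set A : set R := `]0%R, 1%R[%classic.
have mA : measurable A by exact: measurable_itv.
have nA := nneg_measurable_indic mA.
have A0 : A `<=` halfline R by exact: sub_halfline.
have mA1 : mu A = 1 by rewrite lebesgue_measure_itv/= lte_fin ltr01 oppr0 adde0.
have := ri_norm_indic E mA A0; rewrite mA1 ltry => /(_ isT).
have := ri_norm_ge0 E nA.
case eK : (ri_norm E _) => [K| |]// K0 _; exists K => //.
rewrite lt_neqAle -lee_fin K0 andbT; apply/eqP => K00.
move: eK; rewrite -K00 => /(ri_norm_eq0 E nA).1 [N [mN N0 sub]].
suff : mu A <= mu N by rewrite mA1 N0 leNgt lte01.
apply: le_measure; rewrite ?inE// => x Ax; apply: sub => /= H.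
have := A0 _ Ax; rewrite halflineE => /H; rewrite indicE mem_set//.
by move=> [] /eqP; rewrite oner_eq0.
Qed.

(** In the variable ln s these intervals are the translates of a unit interval,
    so their indicator functions are all equimeasurable. *)
Lemma tilde_norm_bump : exists2 K : R, (0 < K)%R &
  forall t, (0 < t)%R -> tilde_norm E `]t, (expR 1 * t)%R[ (cst 1) = K%:E.
Proof.
have [K K0 EK] := ri_norm_unit_interval; exists K => // t t0.
have m1 : nneg_measurable (cst 1 : R -> \bar R) by exact: nneg_measurable_cst.
have mI : measurable (`]t, (expR 1 * t)%R[ : set R) by exact: measurable_itv.
rewrite (tilde_normE E m1 mI) -EK; have nr := nneg_measurable_restrict m1 mI.
have mA : measurable (`]0%R, 1%R[ : set R) by exact: measurable_itv.
apply: ri_norm_equimeasurable.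
- exact: unrolled_nneg_measurable.
- exact: nneg_measurable_indic.
move=> l l0; rewrite unrolled_distribution// indic_superlevel//; last first.
  exact: sub_halfline.
have rE s : (cst 1 \_ `]t, (expR 1 * t)%R[) s = (\1_(`]t, (expR 1 * t)%R[) s)%:E :> \bar R.
  by rewrite patchE indicE; case: (s \in _).
transitivity (mu (if (l < 1)%R then `](ln t), (1 + ln t)%R[ else set0)%classic).
  congr (mu _); case: ltP => l1; apply/seteqP; split=> y //=;
    rewrite rE indicE ?in_itv/=.
  - case: (boolP (_ \in _)) => [/set_mem/=|_]; last by rewrite lte_fin ltNge l0.
    by rewrite -{1 2}(@lnK _ t) ?posrE// -expRD in_itv/= !ltr_expR.
  - move=> yt; rewrite mem_set ?lte_fin//=.
    by rewrite -{1 2}(@lnK _ t) ?posrE// -expRD in_itv/= !ltr_expR.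
  - by rewrite lte_fin; case: (_ \in _) => /=; rewrite ltNge ?l0 ?l1.
case: ifP => // _; rewrite !lebesgue_measure_itv/= !lte_fin ltr01.
by rewrite ltrDr ltr01 -!EFinB; congr EFin; lra.
Qed.

Let geometric_bound (q : R) n : (0 <= q < 1)%R ->
  (\sum_(0 <= k < n) q ^+ k <= (1 - q)^-1)%R.
Proof.
move=> /andP[q0 q1]; have q10 : (0 < 1 - q)%R by rewrite subr_gt0.
rewrite -[leRHS]mul1r ler_pdivlMr//.
rewrite big_mkord mulrC -opprB mulNr -subrX1 opprB gerDl oppr_le0.
exact: exprn_ge0.
Qed.

Let block n (x : R) : \bar R := if Num.truncn x == n then 1 else 0.

(* The n-th partial sum of the series of the q^k times block k. *)
Let head (q : R) n (x : R) : \bar R :=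
  if (Num.truncn x < n)%N then (q ^+ Num.truncn x)%:E else 0.

Let nneg_block n : nneg_measurable (block n).
Proof.
have h : nneg_measurable (fun x => if (Num.truncn x <= n)%N then 1 else 0 : \bar R).
  apply: nonincreasing_nneg_measurable => [t _|s t _ st]; first by case: ifP.
  case: ifP => // tn; first by rewrite (leq_trans (le_truncn st) tn).
  by case: ifP.
have k : nneg_measurable (fun x => if (n <= Num.truncn x)%N then 1 else 0 : \bar R).
  apply: nondecreasing_nneg_measurable => [t _|s t _ st]; first by case: ifP.
  case: ifP => // tn; first by rewrite (leq_trans tn (le_truncn st)).
  by case: ifP.
rewrite (_ : block n = fun x => (if (Num.truncn x <= n)%N then 1 else 0) *
  (if (n <= Num.truncn x)%N then 1 else 0)); first exact: nneg_measurableM.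
by apply/funext => x; rewrite /block; case: ltngtP; rewrite ?mule0 ?mul0e ?mule1.
Qed.

Let ri_norm_block n :
  E (block n) = E (fun x => (\1_(`]0%R, 1%R[) x)%:E).
Proof.
have mA : measurable (`]0%R, 1%R[ : set R) by exact: measurable_itv.
apply: ri_norm_equimeasurable; [exact: nneg_block|exact: nneg_measurable_indic|].
move=> l l0; rewrite indic_superlevel//; last exact: sub_halfline.
transitivity (mu (if (l < 1)%R then [set` if n is 0 then `]0%R, 1%R[
    else `[n%:R, n.+1%:R[] else set0)).
  congr (mu _); case: ltP => l1; apply/seteqP; split=> x //=; rewrite /block.
  - case: eqP => [xn|_ [_]]; last by rewrite lte_fin ltNge l0.
    move=> [x0 _]; move: (truncn_itv (ltW x0)); rewrite xn.
    by case: (n) => [|m]; rewrite in_itv/= ?x0//= => /andP[].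
  - move=> xn; have [x0 xn'] : (0 < x)%R /\ (n%:R <= x < n.+1%:R)%R.
      move: xn; case: (n) => [|m]; rewrite in_itv/=.
        by move=> /andP[x0 x1]; rewrite x0 (ltW x0).
      by move=> /andP[x0 ->]; rewrite x0 (lt_le_trans _ x0)// ltr0n.
    by rewrite (truncn_def xn') eqxx lte_fin.
  - by case: ifP => _ [_]; rewrite lte_fin ltNge ?l0 ?l1.
case: ifP => // _; case: (n) => [//|m].
rewrite !lebesgue_measure_itv/= !lte_fin ltr01 ltr_nat ltnSn.
by rewrite -!EFinB; congr EFin; rewrite -natr1; lra.
Qed.

Let nneg_head q n : (0 <= q <= 1)%R -> nneg_measurable (head q n).
Proof.
move=> /andP[q0 q1].
apply: nonincreasing_nneg_measurable => [t _|s t _ st]; rewrite /head.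
  by case: ifP; rewrite ?lee_fin ?exprn_ge0.
case: ifP => [tn|_]; last by case: ifP; rewrite ?lee_fin ?exprn_ge0.
rewrite (leq_ltn_trans (le_truncn st) tn) lee_fin.
by apply: ler_wiXn2l => //; exact: le_truncn.
Qed.

Let ri_norm_head (q K : R) n : (0 <= q < 1)%R -> (0 <= K)%R ->
  E (fun x => (\1_(`]0%R, 1%R[) x)%:E) = K%:E ->
  E (head q n) <= (K * \sum_(0 <= k < n) q ^+ k)%:E.
Proof.
move=> q01 K0 EK; have /andP[q0 q1] := q01.
have q01' : (0 <= q <= 1)%R by rewrite q0 ltW.
elim: n => [|n IH].
  rewrite big_geq// mulr0 (_ : head q 0 = fun=> 0).
    have n0 : nneg_measurable (fun _ : R => 0 : \bar R).
      exact: nneg_measurable_cst.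
    by rewrite ((ri_norm_eq0 E n0).2 _)//; apply: aeW.
  by apply/funext => x; rewrite /head ltn0.
have nq : nneg_measurable (fun x => (q ^+ n)%:E * block n x).
  apply: nneg_measurableM; last exact: nneg_block.
  by apply: nneg_measurable_cst; rewrite lee_fin exprn_ge0.
apply: (@le_trans _ _ (E (head q n) + E (fun x => (q ^+ n)%:E * block n x))).
  apply: le_trans (ri_normD E (nneg_head n q01') nq).
  apply: ri_norm_le_pointwise; first exact: nneg_head.
    by apply: nneg_measurableD => //; exact: nneg_head.
  move=> x _; rewrite /head /block ltnS leq_eqVlt.
  by case: eqP => [->|_]; rewrite ?ltnn /= ?mule1 ?add0e// mule0 adde0.
rewrite big_nat_recr//= mulrDr EFinD leeD// ri_normZ ?exprn_ge0//.
by rewrite ri_norm_block EK -EFinM mulrC.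
Qed.

(** The exponential is dominated by its values at the integers, that is by a
    geometric series of indicator functions of unit intervals, all of the same
    norm; the Fatou property passes to the limit. *)
Lemma ri_norm_expN (d : R) : (0 < d)%R -> exists2 M : R, (0 < M)%R &
  E (fun x => (expR (- (d * x)))%:E) <= M%:E.
Proof.
move=> d0; pose q := expR (- d).
have q01 : (0 <= q < 1)%R by rewrite expR_ge0 expR_lt1 oppr_lt0.
have /andP[q0 q1] := q01; have q01' : (0 <= q <= 1)%R by rewrite q0 ltW.
have [K K0 EK] := ri_norm_unit_interval.
exists (K * (1 - q)^-1)%R; first by rewrite mulr_gt0// invr_gt0 subr_gt0.
pose f (x : R) : \bar R := (q ^+ Num.truncn x)%:E.
have nf : nneg_measurable f.
  apply: nonincreasing_nneg_measurable => [t _|s t _ st]; rewrite lee_fin.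
    exact: exprn_ge0.
  by apply: (ler_wiXn2l q0 (ltW q1)); exact: le_truncn.
have nexp : nneg_measurable (fun x : R => (expR (- (d * x)))%:E).
  apply: nonincreasing_nneg_measurable => [t _|s t _ st]; rewrite lee_fin.
    exact: expR_ge0.
  by rewrite ler_expR lerN2 ler_pM2l.
apply: (@le_trans _ _ (E f)).
  apply: ri_norm_le_pointwise => // x x0; rewrite lee_fin.
  rewrite /q -expRM_natl ler_expR mulrN lerN2 mulrC ler_pM2l//.
  by rewrite truncn_le ltW.
have := @ri_norm_fatou _ E _ _ (fun n => nneg_head n q01') nf.
have lim x : nondecreasing_seq (fun n => head q n x) /\ head q n x @[n --> \oo] --> f x.
  split=> [m n mn|]; rewrite /head /f.
    case: ifP => [xm|_]; first by rewrite (leq_trans xm mn).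
    by case: ifP; rewrite ?lee_fin ?exprn_ge0.
  apply: cvg_near_cst; exists (Num.truncn x).+1 => // n /= xn.
  by rewrite xn.
move=> /(_ _)/cvge_le_bound; apply; first by apply: aeW => x _; exact: lim.
move=> n.
apply: (le_trans (ri_norm_head n q01 (ltW K0) EK)); rewrite lee_fin.
by rewrite ler_pM2l// geometric_bound.
Qed.

(** Exponential decay in the dilation invariant distance |ln s - ln t|: the model
    for all weights below. *)
Definition decay (e t s : R) : R := expR (- (e * `|ln s - ln t|))%R.

Lemma decay_nneg_measurable (e t : R) : nneg_measurable (EFin \o decay e t).
Proof.
apply: nneg_measurable_EFin => [|s _]; last exact: expR_ge0.
rewrite /decay; apply: measurableT_comp => //.
apply: measurableT_comp => //; apply: measurable_funM => //.
apply: measurableT_comp => //; apply: measurable_funB => //.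
by apply: measurable_funS (@measurable_ln R).
Qed.

(** By dilation invariance the norm does not depend on t. At t = 1 the function
    is an exponential in ln s, which [unroll_growth] compares with an exponential
    on the half-line. *)
Lemma tilde_norm_decay (e : R) : (0 < e)%R -> exists2 M : R, (0 < M)%R &
  forall t, (0 < t)%R -> tilde_norm E (halfline R) (EFin \o decay e t) <= M%:E.
Proof.
move=> e0; have d0 : (0 < e / 2)%R by rewrite divr_gt0.
have [M M0 EM] := ri_norm_expN d0.
exists (expR e * M)%R; first by rewrite mulr_gt0// expR_gt0.
move=> t t0; have mH := measurable_halfline R.
have nd s := decay_nneg_measurable e s.
have -> : tilde_norm E (halfline R) (EFin \o decay e t) =
          tilde_norm E (halfline R) (EFin \o decay e 1).
  rewrite !(tilde_normE E (nd _) mH).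
  have nr s := nneg_measurable_restrict (nd s) mH.
  apply: ri_norm_equimeasurable; [exact: unrolled_nneg_measurable..|].
  move=> l l0; rewrite (unrolled_distribution l (nr t)) (unrolled_distribution l (nr 1%R)).
  have rE s y : ((EFin \o decay e s) \_ (halfline R)) (expR y) =
      (expR (- (e * `|y - ln s|))%R)%:E.
    by rewrite patchE mem_set ?halflineE ?expR_gt0//= /decay expRK.
  rewrite -[RHS](@lebesgue_measure_translation _ (- ln t)); last first.
    have := @emeasurable_fun_o_infty _ _ _ _ _ measurableT
      (measurable_comp_expR (nr 1%R).1) l%:E.
    by rewrite setTI.
  by congr (mu _); apply/seteqP; split=> y; rewrite /= !rE ln1 subr0.
rewrite (tilde_normE E (nd _) mH).
have nexp : nneg_measurable (fun x : R => (expR (- (e / 2 * x)))%:E).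
  apply: nonincreasing_nneg_measurable => [s _|s r _ sr]; rewrite lee_fin.
    exact: expR_ge0.
  by rewrite ler_expR lerN2 ler_pM2l.
rewrite EFinM.
apply: (@le_trans _ _
  ((expR e)%:E * E (fun x : R => (expR (- (e / 2 * x)))%:E))); last first.
  by apply: lee_wpmul2l; rewrite ?lee_fin ?expR_ge0.
rewrite -ri_normZ ?expR_ge0//.
apply: ri_norm_le_pointwise.
- by apply: unrolled_nneg_measurable; exact: nneg_measurable_restrict.
- apply: (nneg_measurableM _ nexp); apply: nneg_measurable_cst.
  by rewrite lee_fin expR_ge0.
move=> x x0; rewrite /unrolled /= patchE mem_set ?halflineE ?expR_gt0//=.
rewrite -EFinM lee_fin -expRD ler_expR expRK ln1 subr0.
have := unroll_growth x0; rewrite -(ler_pM2l e0); lra.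
Qed.

End Calibration.

(** * Slow variation *)

Section Slow.
Variable R : realType.
Implicit Types (a b : R -> R).
Local Open Scope ring_scope.

(** This form of slow variation bounds the ratio of two values directly by the
    logarithmic distance of the points; it is visibly stable under products and
    inverses. *)
Definition slow b := [/\ measurable_fun (halfline R) b,
  forall t, 0 < t -> 0 < b t &
  forall e, 0 < e -> exists2 C, 0 < C &
    forall s t, 0 < s -> 0 < t -> b s <= C * expR (e * `|ln s - ln t|) * b t].

Lemma powR_gt0E (x r : R) : 0 < x -> x `^ r = expR (r * ln x).
Proof. by move=> x0; rewrite /powR gt_eqF. Qed.

(** Monotonicity up to a constant of t^e b(t) controls b(s)/b(t) for s < t, that
    of t^(-e) b(t) controls it for s > t. *)
Lemma slowly_varying_slow b : slowly_varying b -> slow b.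
Proof.
move=> [mb b0 incr decr]; split=> // e e0.
have [g [c [c0 ng gb]]] := incr _ e0; have [h [d [d0 nh hb]]] := decr _ e0.
have M0 : 0 < c * c + d * d by rewrite addr_gt0// mulr_gt0.
exists (c * c + d * d) => // s t s0 t0.
have le_powR (r x y : R) : 0 < x -> 0 < y -> y `^ r = expR (r * (ln y - ln x)) * x `^ r.
  by move=> x0 y0; rewrite !powR_gt0E// -expRD; congr expR; lra.
have [st|/ltW ts] := leP s t.
  have lst : ln s <= ln t by rewrite ler_ln.
  have : s `^ e * b s <= c * (c * (t `^ e * b t)).
    apply: le_trans (gb s s0).1 _; rewrite ler_pM2l//.
    exact: le_trans (ng _ _ s0 st) (gb t t0).2.
  rewrite (le_powR e s t)// => H; have se0 : 0 < s `^ e by rewrite powR_gt0.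
  rewrite ler0_norm ?subr_le0// opprB -(ler_pM2l se0) (le_trans H)//.
  have -> : s `^ e * ((c * c + d * d) * expR (e * (ln t - ln s)) * b t) =
    c * (c * (expR (e * (ln t - ln s)) * s `^ e * b t)) +
    d * (d * (expR (e * (ln t - ln s)) * s `^ e * b t)) by ring.
  by rewrite lerDl !mulr_ge0// ?expR_ge0 ?ltW// b0.
have lst : ln t <= ln s by rewrite ler_ln.
have : s `^ (- e) * b s <= d * (d * (t `^ (- e) * b t)).
  apply: le_trans (hb s s0).1 _; rewrite ler_pM2l//.
  exact: le_trans (nh _ _ t0 ts) (hb t t0).2.
rewrite (le_powR (- e) s t)// => H; have se0 : 0 < s `^ (- e) by rewrite powR_gt0.
rewrite ger0_norm ?subr_ge0// -(ler_pM2l se0) (le_trans H)//.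
have -> : - e * (ln t - ln s) = e * (ln s - ln t) by ring.
have -> : s `^ (- e) * ((c * c + d * d) * expR (e * (ln s - ln t)) * b t) =
  c * (c * (expR (e * (ln s - ln t)) * s `^ (- e) * b t)) +
  d * (d * (expR (e * (ln s - ln t)) * s `^ (- e) * b t)) by ring.
by rewrite lerDr !mulr_ge0// ?expR_ge0 ?ltW// b0.
Qed.

Lemma slowM a b : slow a -> slow b -> slow (fun t => a t * b t).
Proof.
move=> [ma a0 ha] [mb b0 hb]; split=> [|t t0|e e0]; first exact: measurable_funM.
  by rewrite mulr_gt0 ?a0 ?b0.
have e2 : 0 < e / 2 by rewrite divr_gt0.
have [C C0 aC] := ha _ e2; have [D D0 bD] := hb _ e2.
exists (C * D) => [|s t s0 t0]; first exact: mulr_gt0.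
apply: (@le_trans _ _ ((C * expR (e / 2 * `|ln s - ln t|) * a t) *
                       (D * expR (e / 2 * `|ln s - ln t|) * b t))).
  by apply: ler_pM; [exact/ltW/a0|exact/ltW/b0|exact: aC|exact: bD].
set x := `|_|; have -> : e * x = e / 2 * x + e / 2 * x by lra.
rewrite expRD le_eqVlt; apply/orP; left; apply/eqP; ring.
Qed.

Lemma slowV b : slow b -> slow (fun t => (b t)^-1).
Proof.
move=> [mb b0 hb]; split=> [|t t0|e e0]; last 2 first.
- by rewrite invr_gt0 b0.
- have [C C0 bC] := hb _ e0; exists C => // s t s0 t0.
  rewrite ler_pdivlMr ?b0// mulrC ler_pdivrMr ?b0// distrC.
  exact: bC.
apply: (eq_measurable_fun (fun t => b t `^ (-1))) => [t|].
  by rewrite inE halflineE => t0; rewrite powR_inv1// ltW// b0.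
exact: (measurableT_comp (measurable_powR _) mb).
Qed.

(** On the side of t where the power s^k decreases, half of its exponent absorbs
    the slow factor and the other half remains as decay. *)
Lemma power_slow_decay (k : R) a : k != 0 -> slow a ->
  exists2 C, 0 < C & forall s t, 0 < s -> 0 < t -> k * (ln s - ln t) <= 0 ->
    s `^ k * a s <= C * (t `^ k * a t) * decay (`|k| / 2) t s.
Proof.
move=> k0 [_ a0 ha]; have k2 : 0 < `|k| / 2 by rewrite divr_gt0 ?normr_gt0.
have [C C0 aC] := ha _ k2; exists C => // s t s0 t0 kst.
rewrite !powR_gt0E// /decay.
apply: (@le_trans _ _ (expR (k * ln s) * (C * expR (`|k| / 2 * `|ln s - ln t|) * a t))).
  by rewrite ler_pM2l ?expR_gt0//; exact: aC.
have E : `|k| * `|ln s - ln t| = - (k * (ln s - ln t)) by rewrite -normrM ler0_norm.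
(* One half of the exponent pays for the slow factor, the other is the decay. *)
have -> : k * ln s = k * ln t - `|k| / 2 * `|ln s - ln t| - `|k| / 2 * `|ln s - ln t|.
  rewrite [RHS](_ : _ = k * ln t - `|k| * `|ln s - ln t|); last by field.
  by rewrite E; ring.
rewrite !expRD !expRN; set x := expR (_ / _ * _); have x0 : x != 0 by rewrite gt_eqF// expR_gt0.
rewrite le_eqVlt; apply/orP; left; apply/eqP; field.
by rewrite x0.
Qed.

(** At logarithmic distance at most 1 both factors change by a bounded ratio. *)
Lemma power_slow_comparable (k : R) a : slow a ->
  exists2 C, 0 < C & forall s t, 0 < s -> 0 < t -> `|ln s - ln t| <= 1 ->
    t `^ k * a t <= C * (s `^ k * a s).
Proof.
move=> [_ a0 ha]; have [C C0 aC] := ha _ ltr01.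
exists (expR `|k| * (C * expR 1)) => [|s t s0 t0 st].
  by rewrite !mulr_gt0// expR_gt0.
have -> : expR `|k| * (C * expR 1) * (s `^ k * a s) =
  (expR `|k| * s `^ k) * (C * expR 1 * a s) by ring.
apply: ler_pM; [exact: powR_ge0|exact/ltW/a0| |].
  rewrite !powR_gt0E// -expRD ler_expR -lerBlDr -mulrBr.
  rewrite (le_trans (ler_norm _))// normrM distrC.
  by rewrite ler_piMr.
apply: le_trans (aC _ _ t0 s0) _; rewrite ler_pM2r ?a0// ler_pM2l// ler_expR.
by rewrite mul1r distrC.
Qed.

End Slow.

(** * Norms of powers times slow functions *)

Section WeightNorms.
Variables (R : realType) (E : ri_space R).
Implicit Types (a b : R -> R) (f : R -> \bar R) (I : set R).

Lemma nneg_measurable_slow b : slow b -> nneg_measurable (EFin \o b).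
Proof.
by move=> [mb b0 _]; apply: nneg_measurable_EFin => // t /b0/ltW.
Qed.

Lemma nneg_measurable_power_slow (k : R) a : slow a ->
  nneg_measurable (fun s => (s `^ k * a s)%:E).
Proof.
move=> [ma a0 _]; apply: (@nneg_measurable_EFin _ (fun s => s `^ k * a s)%R).
  apply: measurable_funM => //.
  by apply: measurable_funS (measurable_powR k).
by move=> t t0; rewrite mulr_ge0 ?powR_ge0// ltW ?a0.
Qed.

Lemma tilde_norm_le_decay (e : R) : (0 < e)%R -> exists2 M : R, (0 < M)%R &
  forall (D t : R) I f, (0 <= D)%R -> (0 < t)%R -> measurable I ->
    nneg_measurable f ->
    (forall s, (0 < s)%R -> I s -> f s <= (D * decay e t s)%:E) ->
    tilde_norm E I f <= (D * M)%:E.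
Proof.
move=> e0; have [M M0 EM] := tilde_norm_decay E e0; exists M => // D t I f D0 t0 mI nf fD.
have nd := decay_nneg_measurable e t; have mH := measurable_halfline R.
rewrite EFinM; apply: le_trans (lee_wpmul2l _ (EM t t0)); last by rewrite lee_fin.
rewrite -(tilde_normZ E D0 nd mH).
apply: (tilde_norm_le E nf _ mI mH).
  by apply: (nneg_measurableM _ nd); apply: nneg_measurable_cst; rewrite lee_fin.
move=> s s0 Is; rewrite halflineE; split=> //.
by rewrite /= -EFinM; exact: fD.
Qed.

(** The weight is at most its value at t times a decaying function, and the norm
    of the latter is bounded uniformly in t. *)
Lemma tilde_norm_power_slow_le (k : R) a : k != 0%R -> slow a ->
  exists2 C : R, (0 < C)%R & forall t I, (0 < t)%R -> measurable I ->
    (forall s, (0 < s)%R -> I s -> (k * (ln s - ln t) <= 0)%R) ->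
    tilde_norm E I (fun s => (s `^ k * a s)%:E) <= (C * (t `^ k * a t))%:E.
Proof.
move=> k0 sa; have [C C0 aC] := power_slow_decay k0 sa.
have k2 : (0 < `|k| / 2)%R by rewrite divr_gt0 ?normr_gt0.
have [M M0 EM] := tilde_norm_le_decay k2.
exists (C * M)%R => [|t I t0 mI It]; first exact: mulr_gt0.
have -> : (C * M * (t `^ k * a t) = C * (t `^ k * a t) * M)%R by ring.
have a0 : (0 < a t)%R by case: sa => _ + _; apply.
apply: (EM _ t) => //.
- by rewrite !mulr_ge0 ?powR_ge0// ltW.
- exact: nneg_measurable_power_slow.
- by move=> s s0 Is; rewrite lee_fin aC// It.
Qed.

(** The weight is comparable to its value at t on an interval of logarithmic
    length 1 next to t, and such intervals have a fixed positive norm. *)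
Lemma tilde_norm_power_slow_ge (k : R) a : slow a ->
  exists2 C : R, (0 < C)%R & forall t r I, (0 < r)%R -> (r <= t)%R ->
    (t <= expR 1 * r)%R -> measurable I -> `]r, (expR 1 * r)%R[ `<=` I ->
    (t `^ k * a t)%:E <= C%:E * tilde_norm E I (fun s => (s `^ k * a s)%:E).
Proof.
move=> sa; have [C C0 aC] := power_slow_comparable k sa.
have [K K0 EK] := tilde_norm_bump E.
exists (C / K)%R => [|t r I r0 rt tr mI sI]; first exact: divr_gt0.
have t0 : (0 < t)%R by exact: lt_le_trans rt.
have n1 : nneg_measurable (cst 1 : R -> \bar R) by exact: nneg_measurable_cst.
have mJ : measurable (`]r, (expR 1 * r)%R[ : set R) by exact: measurable_itv.
have np := nneg_measurable_power_slow k sa.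
have p0 : (0 <= t `^ k * a t)%R.
  by rewrite mulr_ge0 ?powR_ge0//; case: sa => _ /(_ t t0)/ltW.
set p := (_ * a t)%R in p0 *.
have q0 : (0 <= p / C)%R by rewrite divr_ge0// ltW.
have h : (p / C * K)%:E <= tilde_norm E I (fun s => (s `^ k * a s)%:E).
  have nq : nneg_measurable (fun s : R => (p / C)%:E * cst 1 s).
    by apply: (nneg_measurableM _ n1); apply: nneg_measurable_cst; rewrite lee_fin.
  rewrite EFinM -(EK _ r0) -(tilde_normZ E q0 n1 mJ).
  apply: (tilde_norm_le E nq np mJ mI) => s s0 Js; split; first exact: sI.
  rewrite mule1 lee_fin ler_pdivrMr// mulrC; apply: aC => //.
  have lr (x y : R) : (0 < x)%R -> (x <= y)%R -> (ln x <= ln y)%R.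
    by move=> x0 xy; rewrite ler_ln// posrE (lt_le_trans x0).
  have er : (ln (expR 1 * r) = 1 + ln r)%R by rewrite lnM ?posrE ?expR_gt0// expRK.
  move: Js; rewrite /= in_itv/= => /andP[/ltW/(lr _ _ r0) rs /ltW/(lr _ _ s0)].
  move: (lr _ _ r0 rt) (lr _ _ t0 tr); rewrite er => h1 h2 h3.
  by rewrite ler_norml; apply/andP; split; lra.
apply: le_trans (lee_wpmul2l _ h); last by rewrite lee_fin divr_ge0// ltW.
rewrite -EFinM lee_fin le_eqVlt; apply/orP; left; apply/eqP.
by field; rewrite !gt_eqF.
Qed.

Definition initial_norm b (u : R) : R := fine (tilde_norm E `]0%R, u[ (EFin \o b)).

Section InitialNorm.
Variable b : R -> R.
Hypothesis sb : slow b.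
Hypothesis finb : tilde_norm E `]0%R, 1%R[ (EFin \o b) < +oo.

Let nb : nneg_measurable (EFin \o b).
Proof. exact: nneg_measurable_slow. Qed.

Let m0 (u : R) : measurable (`]0%R, u[ : set R).
Proof. exact: measurable_itv. Qed.

Let B u := tilde_norm E `]0%R, u[ (EFin \o b).

Lemma slow_le_initial_norm : exists2 C : R, (0 < C)%R &
  forall u, (0 < u)%R -> (b u)%:E <= C%:E * B u.
Proof.
have [C C0 H] := tilde_norm_power_slow_ge 0 sb; exists C => // u u0.
(* The unit interval is taken on the left of u to stay inside (0, u). *)
have r0 : (0 < expR (- 1) * u)%R by rewrite mulr_gt0 ?expR_gt0.
have rE : (expR 1 * (expR (- 1) * u) = u)%R.
  by rewrite mulrA -expRD subrr expR0 mul1r.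
have := H u (expR (- 1) * u)%R `]0%R, u[%classic r0.
rewrite rE powRr0 mul1r lexx /B.
rewrite (_ : EFin \o b = fun s => (s `^ 0 * b s)%:E); last first.
  by apply/funext => s; rewrite powRr0 mul1r.
apply=> //; first by rewrite ger_pMl// expR_le1 oppr_le0.
by move=> s /=; rewrite !in_itv/= => /andP[rs ->]; rewrite (lt_trans r0).
Qed.

(** On [s, t) the function b is controlled by b(s), which is itself controlled by
    the norm over (0, s). Besides slow variation this gives finiteness for all u
    from finiteness at 1. *)
Lemma initial_norm_growth (e : R) : (0 < e)%R -> exists2 C : R, (0 < C)%R &
  forall s t, (0 < s)%R -> (s <= t)%R ->
    B t <= (C * expR (e * `|ln s - ln t|))%:E * B s.
Proof.
move=> e0; have e2 : (0 < e / 2)%R by rewrite divr_gt0.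
have [C C0 bC] : exists2 C : R, (0 < C)%R & forall s t, (0 < s)%R -> (0 < t)%R ->
    (b s <= C * expR (e / 2 * `|ln s - ln t|) * b t)%R.
  by case: sb => _ _; apply.
have [M M0 EM] := tilde_norm_le_decay e2.
have [D D0 bD] := slow_le_initial_norm.
exists (1 + C * M * D)%R => [|s t s0 st]; first by rewrite addr_gt0 ?mulr_gt0.
have lst : (ln s <= ln t)%R by rewrite ler_ln// posrE (lt_le_trans s0).
have b0 : (0 < b s)%R by case: sb => _ + _; apply.
have mst : measurable (`[s, t[ : set R) by exact: measurable_itv.
have -> : `|ln s - ln t|%R = (ln t - ln s)%R.
  by rewrite distrC ger0_norm ?subr_ge0.
set X := expR _; have X1 : (1 <= X)%R.
  by rewrite /X -expR0 ler_expR mulr_ge0 ?subr_ge0// ltW.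
have X0 : (0 <= X)%R by exact: le_trans X1.
have step : tilde_norm E `[s, t[ (EFin \o b) <= (C * X * b s * M)%:E.
  apply: (EM _ s) => //; first by rewrite !mulr_ge0// ltW.
  move=> x x0 /=; rewrite in_itv/= => /andP[sx xt]; rewrite lee_fin.
  apply: le_trans (bC _ _ x0 s0) _.
  have -> : (C * X * b s * decay (e / 2) s x = C * (X * decay (e / 2) s x) * b s)%R by ring.
  rewrite ler_pM2r// ler_pM2l// -expRD ler_expR.
  have lsx : (ln s <= ln x)%R by rewrite ler_ln// posrE.
  have lxt : (ln x <= ln t)%R by rewrite ler_ln ?posrE ?(ltW xt)// (lt_trans x0).
  rewrite ger0_norm ?subr_ge0//; set p := ln s; nra.
have Bs0 : 0 <= B s by exact: tilde_norm_ge0.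
apply: (@le_trans _ _ (B s + tilde_norm E `[s, t[ (EFin \o b))).
  apply: le_trans (tilde_normU E nb (m0 s) mst).
  apply: (tilde_norm_le E nb nb (m0 t)); first exact: measurableU.
  move=> x x0 /=; rewrite !in_itv/= x0/= => xt; split=> //.
  by have [_|_] := ltP x s; [left|right; rewrite xt].
rewrite mulrDl mul1r EFinD ge0_muleDl ?lee_fin//; last by rewrite !mulr_ge0// ltW.
apply: leeD; first by rewrite lee_pemull// lee_fin.
apply: (le_trans step).
have -> : (C * X * b s * M = C * M * X * b s)%R by ring.
have -> : (C * M * D * X = C * M * X * D)%R by ring.
rewrite (EFinM _ (b s)) (EFinM _ D) -muleA; apply: lee_wpmul2l; last exact: bD.
by rewrite lee_fin !mulr_ge0// ltW.
Qed.

Lemma initial_normE u : (0 < u)%R -> B u = (initial_norm b u)%:E.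
Proof.
move=> u0; rewrite fineK//.
have fin s t : (0 < s)%R -> (s <= t)%R -> B s < +oo -> B t < +oo.
  move=> s0 st Bs; have [C C0 H] := initial_norm_growth ltr01.
  apply: (le_lt_trans (H _ _ s0 st)).
  have : B s \is a fin_num by rewrite ge0_fin_numE// tilde_norm_ge0.
  by move=> /fineK <-; rewrite -EFinM ltry.
rewrite ge0_fin_numE; last exact: tilde_norm_ge0.
have [u1|/ltW u1] := leP 1%R u; first exact: fin finb.
apply: le_lt_trans finb; apply: (tilde_norm_le E nb nb (m0 u) (m0 1%R)) => t t0 /=.
by rewrite !in_itv/= t0/= => tu; split=> //; exact: lt_le_trans u1.
Qed.

(** Growth in u is limited by [initial_norm_growth], and decay is excluded by
    monotonicity. *)
Lemma initial_norm_slow : slow (initial_norm b).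
Proof.
have pos t : (0 < t)%R -> (0 < initial_norm b t)%R.
  move=> t0; have [C C0 H] := slow_le_initial_norm.
  have := H t t0; rewrite initial_normE// -EFinM lee_fin => h.
  have bt : (0 < b t)%R by case: sb => _ + _; apply.
  by rewrite -(pmulr_rgt0 _ C0); exact: lt_le_trans h.
have incr s t : (0 < s)%R -> (s <= t)%R -> (initial_norm b s <= initial_norm b t)%R.
  move=> s0 st.
  have : B s <= B t.
    apply: (tilde_norm_le E nb nb (m0 s) (m0 t)) => x x0 /=.
    by rewrite !in_itv/= x0/= => xs; split=> //; exact: lt_le_trans st.
  by rewrite (initial_normE s0) (initial_normE (lt_le_trans s0 st)) lee_fin.
split=> //.
  have : nneg_measurable (EFin \o initial_norm b).
    apply: nondecreasing_nneg_measurable => [t t0|s t s0 st]; rewrite lee_fin ?incr//.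
    by rewrite ltW// pos.
  by move=> [/measurable_EFinP].
move=> e e0; have [C C0 H] := initial_norm_growth e0.
exists (1 + C)%R => [|s t s0 t0]; first by rewrite addr_gt0.
have X1 : (1 <= expR (e * `|ln s - ln t|))%R.
  by rewrite -expR0 ler_expR mulr_ge0// ltW.
have Bt0 := pos t t0.
have [st|/ltW ts] := leP s t.
  apply: le_trans (incr _ _ s0 st) _; rewrite ler_peMl//; first exact: ltW.
  by rewrite -[leLHS]mulr1 ler_pM// lerDl ltW.
have := H _ _ t0 ts; rewrite !initial_normE// -EFinM lee_fin distrC => h.
apply: le_trans h _; rewrite ler_pM2r// ler_pM2r ?(lt_le_trans ltr01)//.
by rewrite lerDr.
Qed.

End InitialNorm.

End WeightNorms.

(** * Weighted and nested norms *)

Definition nneg_nondecreasing (R : realType) (phi : R -> \bar R) : Prop :=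
  (forall t, (0 < t)%R -> 0 <= phi t) /\
  (forall s t, (0 < s)%R -> (s <= t)%R -> phi s <= phi t).

Section MoreTilde.
Variables (R : realType) (E : ri_space R).

Lemma tilde_norm_mule_le (M : \bar R) (I : set R) (f : R -> \bar R) : 0 <= M ->
  nneg_measurable f -> measurable I -> 0 < tilde_norm E I f ->
  tilde_norm E I (fun t => M * f t) <= M * tilde_norm E I f.
Proof.
case: M => [c|_|//]; first by rewrite lee_fin => c0 nf mI _; rewrite tilde_normZ.
by move=> nf mI T0; rewrite (gt0_mulye T0) leey.
Qed.

End MoreTilde.

Definition weighted_norm (R : realType) (F : ri_space R) (theta : R) (a : R -> R)
    (I : set R) (phi : R -> \bar R) : \bar R :=
  tilde_norm F I (fun s => (s `^ (- theta) * a s)%:E * phi s).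

Section WeightedNorm.
Variables (R : realType) (F : ri_space R) (theta : R) (a : R -> R).
Hypothesis sa : slow a.
Implicit Types (I J : set R) (phi psi : R -> \bar R).
Local Notation W := (weighted_norm F theta a).

Lemma nneg_nondecreasing_measurable phi : nneg_nondecreasing phi -> nneg_measurable phi.
Proof. by move=> [phi0 dphi]; exact: nondecreasing_nneg_measurable. Qed.

Lemma nneg_measurable_weighted phi : nneg_measurable phi ->
  nneg_measurable (fun s => (s `^ (- theta) * a s)%:E * phi s).
Proof. exact: (nneg_measurableM (nneg_measurable_power_slow (- theta) sa)). Qed.

Let weight_ge0 (s : R) : (0 < s)%R -> 0 <= (s `^ (- theta) * a s)%:E.
Proof.
by move=> s0; rewrite lee_fin mulr_ge0 ?powR_ge0//; case: sa => _ /(_ s s0)/ltW.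
Qed.

Lemma weighted_norm_ge0 I phi : measurable I -> nneg_measurable phi -> 0 <= W I phi.
Proof. by move=> mI /nneg_measurable_weighted n; exact: tilde_norm_ge0. Qed.

Lemma weighted_norm_le I J phi psi : measurable I -> measurable J ->
  nneg_measurable phi -> nneg_measurable psi ->
  (forall s, (0 < s)%R -> I s -> J s /\ phi s <= psi s) -> W I phi <= W J psi.
Proof.
move=> mI mJ n1 n2 h.
apply: (tilde_norm_le F (nneg_measurable_weighted n1) (nneg_measurable_weighted n2) mI mJ).
move=> s s0 /(h s s0)[Js le]; split=> //.
by apply: lee_wpmul2l => //; exact: weight_ge0.
Qed.

Lemma weighted_normD I phi psi : measurable I -> nneg_measurable phi ->
  nneg_measurable psi -> W I (fun s => phi s + psi s) <= W I phi + W I psi.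
Proof.
move=> mI n1 n2.
apply: le_trans (tilde_normD F (nneg_measurable_weighted n1) (nneg_measurable_weighted n2) mI).
apply: (tilde_norm_le F _ _ mI mI).
- exact: (nneg_measurable_weighted (nneg_measurableD n1 n2)).
- by apply: nneg_measurableD; exact: nneg_measurable_weighted.
move=> s s0 Is; split=> //; rewrite ge0_muleDr//; first by case: n1 => _; apply.
by case: n2 => _; apply.
Qed.

Lemma weighted_normZ (c : R) I phi : (0 <= c)%R -> measurable I ->
  nneg_measurable phi -> W I (fun s => c%:E * phi s) = c%:E * W I phi.
Proof.
move=> c0 mI n1; rewrite /weighted_norm -(tilde_normZ F c0 (nneg_measurable_weighted n1) mI).
by congr (tilde_norm F I _); apply/funext => s; rewrite muleCA.
Qed.

Lemma weighted_normU I J phi : measurable I -> measurable J -> nneg_measurable phi ->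
  W (I `|` J) phi <= W I phi + W J phi.
Proof.
by move=> mI mJ n1; exact: (tilde_normU F (nneg_measurable_weighted n1) mI mJ).
Qed.

(** Since phi increases, it is at least phi(t) on (t, oo), and the weight alone
    has norm comparable to its value at t. *)
Lemma weighted_norm_ge_value : exists2 C : R, (0 < C)%R &
  forall t phi, (0 < t)%R -> nneg_nondecreasing phi ->
    phi t * (t `^ (- theta) * a t)%:E <= C%:E * W `]t, +oo[ phi.
Proof.
have [C C0 H] := tilde_norm_power_slow_ge F (- theta) sa.
exists C => // t phi t0 nphi; have mI : measurable (`]t, +oo[ : set R) by exact: measurable_itv.
have np := nneg_measurable_power_slow (- theta) sa.
have phit : 0 <= phi t by case: nphi => + _; apply.
have h : (t `^ (- theta) * a t)%:E <=
    C%:E * tilde_norm F `]t, +oo[ (fun s => (s `^ (- theta) * a s)%:E).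
  apply: (H t t `]t, +oo[%classic) => //.
    by rewrite ler_peMl ?(ltW t0)// -expR0 ler_expR.
  by move=> s /=; rewrite !in_itv/= => /andP[->].
apply: le_trans (lee_wpmul2l phit h) _.
rewrite muleCA; apply: lee_wpmul2l; first by rewrite lee_fin ltW.
apply: le_trans (tilde_norm_mule_ge F phit np mI) _.
have nphi' := nneg_nondecreasing_measurable nphi.
apply: (tilde_norm_le F _ (nneg_measurable_weighted nphi') mI mI).
  by apply: (nneg_measurableM _ np); exact: nneg_measurable_cst.
move=> s s0 Is; split=> //; rewrite muleC; apply: lee_wpmul2l; first exact: weight_ge0.
by case: nphi => _; apply => //; move: Is; rewrite /= in_itv/= andbT => /ltW.
Qed.

(** Together with the weight, the comparison function is a nonzero power times a
    slow function. *)
Lemma weighted_norm_le_power (k : R) (c : R -> R) : k != theta -> slow c ->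
  exists2 C : R, (0 < C)%R & forall (D t : R) I phi, (0 <= D)%R -> (0 < t)%R ->
    measurable I -> nneg_measurable phi ->
    (forall s, (0 < s)%R -> I s -> ((k - theta) * (ln s - ln t) <= 0)%R) ->
    (forall s, (0 < s)%R -> I s -> phi s <= (D * (s `^ k * c s))%:E) ->
    W I phi <= (C * D * (t `^ (k - theta) * (a t * c t)))%:E.
Proof.
move=> kt sc; have k0 : (k - theta != 0)%R by rewrite subr_eq0.
have [C C0 H] := tilde_norm_power_slow_le F k0 (slowM sa sc).
exists C => // D t I phi D0 t0 mI nphi It le.
rewrite (mulrC C) -mulrA EFinM.
apply: le_trans (lee_wpmul2l _ (H t I t0 mI It)); last by rewrite lee_fin.
have np := nneg_measurable_power_slow (k - theta) (slowM sa sc).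
rewrite -(tilde_normZ F D0 np mI).
apply: (tilde_norm_le F (nneg_measurable_weighted nphi) _ mI mI).
  by apply: (nneg_measurableM _ np); apply: nneg_measurable_cst; rewrite lee_fin.
move=> s s0 Is; split=> //.
apply: le_trans (lee_wpmul2l (weight_ge0 s0) (le s s0 Is)) _.
rewrite -!EFinM lee_fin !(powR_gt0E _ s0).
have -> : ((k - theta) * ln s = - theta * ln s + k * ln s)%R by ring.
by rewrite expRD le_eqVlt; apply/orP; left; apply/eqP; ring.
Qed.

End WeightedNorm.


Lemma slow1 (R : realType) : slow (fun _ : R => 1%R).
Proof.
split=> // e e0; exists 1%R => // s t _ _.
by rewrite mul1r mulr1 -expR0 ler_expR mulr_ge0// ltW.
Qed.

Section NestedNorm.
Variables (R : realType) (E F : ri_space R) (theta : R) (a b : R -> R).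
Hypotheses (sa : slow a) (sb : slow b).
Hypothesis finb : tilde_norm E `]0%R, 1%R[ (EFin \o b) < +oo.
Implicit Types (I : set R) (J : R -> set R) (phi psi : R -> \bar R).
Local Notation W := (weighted_norm F theta a).
Local Notation B := (initial_norm E b).

(** The inner intervals shrink as t grows, so that the inner norm is monotone and
    therefore measurable in t. *)
Definition nested J : Prop :=
  (forall t, measurable (J t)) /\ (forall s t, (s <= t)%R -> J t `<=` J s).

Definition nested_norm I J phi : \bar R :=
  tilde_norm E I (fun t => (b t)%:E * W (J t) phi).

Definition tail_from (t : R) : set R := `]t, +oo[.
Definition window_to (u t : R) : set R := `]t, u[.

Lemma nested_tail : nested tail_from.
Proof.
split=> [t|s t st x]; first exact: measurable_itv.
by rewrite /tail_from/= !in_itv/= !andbT; exact: le_lt_trans.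
Qed.

Lemma nested_window u : nested (window_to u).
Proof.
split=> [t|s t st x]; first exact: measurable_itv.
by rewrite /window_to/= !in_itv/= => /andP[tx ->]; rewrite (le_lt_trans st tx).
Qed.

Lemma nneg_measurable_nested J phi : nested J -> nneg_measurable phi ->
  nneg_measurable (fun t => (b t)%:E * W (J t) phi).
Proof.
move=> [mJ dJ] nphi; apply: (nneg_measurableM (nneg_measurable_slow sb)).
apply: nonincreasing_nneg_measurable => [t _|s t _ st].
  exact: weighted_norm_ge0.
by apply: weighted_norm_le => // x _ Jx; split=> //; exact: dJ Jx.
Qed.

Lemma nested_norm_ge0 I J phi : measurable I -> nested J -> nneg_measurable phi ->
  0 <= nested_norm I J phi.
Proof. by move=> mI nJ /(nneg_measurable_nested nJ) n; exact: tilde_norm_ge0. Qed.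

Lemma nested_norm_le I I' J J' phi psi : measurable I -> measurable I' ->
  nested J -> nested J' -> nneg_measurable phi -> nneg_measurable psi ->
  (forall t, (0 < t)%R -> I t -> I' t /\ W (J t) phi <= W (J' t) psi) ->
  nested_norm I J phi <= nested_norm I' J' psi.
Proof.
move=> mI mI' nJ nJ' n1 n2 h.
apply: (tilde_norm_le E (nneg_measurable_nested nJ n1) (nneg_measurable_nested nJ' n2) mI mI').
move=> t t0 /(h t t0)[I't le]; split; first exact: I't.
by apply: lee_wpmul2l le; rewrite lee_fin; case: sb => _ /(_ t t0)/ltW.
Qed.

Lemma nested_normZ (c : R) I J phi : (0 <= c)%R -> measurable I -> nested J ->
  nneg_measurable phi ->
  nested_norm I J (fun s => c%:E * phi s) = c%:E * nested_norm I J phi.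
Proof.
move=> c0 mI nJ n1.
rewrite /nested_norm -(tilde_normZ E c0 (nneg_measurable_nested nJ n1) mI).
congr (tilde_norm E I _); apply/funext => t.
by rewrite (weighted_normZ F theta sa c0 (nJ.1 t) n1) muleCA.
Qed.

Lemma nested_normD I J phi psi : measurable I -> nested J ->
  nneg_measurable phi -> nneg_measurable psi ->
  nested_norm I J (fun s => phi s + psi s) <= nested_norm I J phi + nested_norm I J psi.
Proof.
move=> mI nJ n1 n2; have mJ t : measurable (J t) by case: nJ.
have nn1 := nneg_measurable_nested nJ n1; have nn2 := nneg_measurable_nested nJ n2.
apply: le_trans (tilde_normD E nn1 nn2 mI).
apply: (tilde_norm_le E _ (nneg_measurableD nn1 nn2) mI mI).
  exact: (nneg_measurable_nested nJ (nneg_measurableD n1 n2)).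
move=> t t0 It; split=> //.
rewrite -ge0_muleDr; [|exact: weighted_norm_ge0..].
apply: lee_wpmul2l; last exact: weighted_normD.
by rewrite lee_fin; case: sb => _ /(_ t t0)/ltW.
Qed.

Lemma nested_norm_quasi (Q : R) I J phi phi0 phi1 : (0 <= Q)%R ->
  measurable I -> nested J -> nneg_measurable phi ->
  nneg_measurable phi0 -> nneg_measurable phi1 ->
  (forall s, (0 < s)%R -> phi s <= Q%:E * (phi0 s + phi1 s)) ->
  nested_norm I J phi <= Q%:E * (nested_norm I J phi0 + nested_norm I J phi1).
Proof.
move=> Q0 mI nJ n n0 n1 h; have n01 := nneg_measurableD n0 n1.
apply: le_trans (lee_wpmul2l _ (nested_normD mI nJ n0 n1)); last by rewrite lee_fin.
have nQ : nneg_measurable (fun s => Q%:E * (phi0 s + phi1 s)).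
  by apply: (nneg_measurableM _ n01); apply: nneg_measurable_cst; rewrite lee_fin.
rewrite -(nested_normZ Q0 mI nJ n01); apply: (nested_norm_le mI mI nJ nJ n nQ).
move=> t t0 It; split; first exact: It.
apply: (weighted_norm_le F _ sa (nJ.1 t) (nJ.1 t) n nQ) => s s0 Js.
by split; [exact: Js|exact: h].
Qed.

Lemma initial_norm_gt0 u : (0 < u)%R -> (0 < B u)%R.
Proof. by move=> u0; case: (initial_norm_slow sb finb) => _ + _; apply. Qed.

Let b_ge0 t : (0 < t)%R -> 0 <= (b t)%:E.
Proof. by move=> t0; rewrite lee_fin; case: sb => _ /(_ t t0)/ltW. Qed.

Let m0 (u : R) : measurable (`]0%R, u[ : set R).
Proof. exact: measurable_itv. Qed.

Let mtail (u : R) : measurable (tail_from u).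
Proof. exact: measurable_itv. Qed.

Let nb : nneg_measurable (EFin \o b).
Proof. exact: nneg_measurable_slow. Qed.

(** For t < u the inner norm over (t, oo) is at least the one over (u, oo), which
    factors out of the outer norm over (0, u). *)
Lemma tail_le_nested_norm u phi : (0 < u)%R -> nneg_measurable phi ->
  (B u)%:E * W (tail_from u) phi <= nested_norm (halfline R) tail_from phi.
Proof.
move=> u0 n1; rewrite -(initial_normE sb finb u0) muleC.
have W0 : 0 <= W (tail_from u) phi by exact: weighted_norm_ge0.
apply: le_trans (tilde_norm_mule_ge E W0 nb (m0 u)) _.
apply: (tilde_norm_le E _ (nneg_measurable_nested nested_tail n1) (m0 u) (measurable_halfline R)).
  by apply: (nneg_measurableM _ nb); exact: nneg_measurable_cst.
move=> t t0; rewrite halflineE /= in_itv/= t0/= => tu; split=> //.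
rewrite muleC; apply: lee_wpmul2l; first exact: b_ge0.
apply: (weighted_norm_le F _ sa (mtail u) (mtail t) n1 n1) => s _ us; split=> //.
by move: us; apply: (nested_tail.2); exact: ltW.
Qed.

(** For phi = K(., f) this bounds K by the norm of f: [tail_le_nested_norm] passes
    to the inner norm and [weighted_norm_ge_value] to the value at t. *)
Lemma nested_norm_ge_value : exists2 C : R, (0 < C)%R &
  forall (n : R) phi, nneg_nondecreasing phi ->
    nested_norm (halfline R) tail_from phi = n%:E ->
    forall t, (0 < t)%R -> phi t <= (C * n * (t `^ theta * (a t * B t)^-1))%:E.
Proof.
have [C C0 H] := weighted_norm_ge_value F theta sa.
exists C => // n phi nphi nE t t0.
have n1 := nneg_nondecreasing_measurable nphi.
have a0 : (0 < a t)%R by case: sa => _ + _; apply.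
have B0 := initial_norm_gt0 t0.
have p0 : (0 < t `^ (- theta))%R by rewrite powR_gt0.
have h1 : (B t)%:E * (phi t * (t `^ (- theta) * a t)%:E) <=
    (B t)%:E * (C%:E * W (tail_from t) phi).
  by apply: lee_wpmul2l (H t phi t0 nphi); rewrite lee_fin ltW.
have h2 : phi t * (B t * (t `^ (- theta) * a t))%:E <= (C * n)%:E.
  rewrite EFinM muleCA (EFinM C) -nE; apply: (le_trans h1).
  rewrite muleCA; apply: lee_wpmul2l; first by rewrite lee_fin ltW.
  exact: tail_le_nested_norm.
have x0 : (0 < B t * (t `^ (- theta) * a t))%R by rewrite !mulr_gt0.
have -> : (C * n * (t `^ theta * (a t * B t)^-1) =
    C * n * (B t * (t `^ (- theta) * a t))^-1)%R.
  have -> : (t `^ theta = (t `^ (- theta))^-1)%R by rewrite powRN invrK.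
  by field; rewrite !gt_eqF.
by rewrite EFinM lee_pdivlMr.
Qed.

End NestedNorm.

(** * Cutting the nested norm at a point *)

Section ThreeParts.
Variables (R : realType) (E F : ri_space R) (theta : R) (a b : R -> R).
Hypotheses (sa : slow a) (sb : slow b).
Hypothesis finb : tilde_norm E `]0%R, 1%R[ (EFin \o b) < +oo.
Implicit Types (I : set R) (J : R -> set R) (phi psi : R -> \bar R).
Local Notation W := (weighted_norm F theta a).
Local Notation B := (initial_norm E b).
Local Notation N := (nested_norm E F theta a b).

(** The nested norm is cut at u in both variables: s and t below u, t below and s
    above u, s and t above u. In the second region the variables separate. *)
Definition head_part u phi := N `]0%R, u[ (window_to u) phi.
Definition middle_part u phi := (B u)%:E * W (tail_from u) phi.
Definition tail_part u phi := N (tail_from u) (@tail_from R) phi.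

Let b_ge0 t : (0 < t)%R -> 0 <= (b t)%:E.
Proof. by move=> t0; rewrite lee_fin; case: sb => _ /(_ t t0)/ltW. Qed.

Let m0 (u : R) : measurable (`]0%R, u[ : set R).
Proof. exact: measurable_itv. Qed.

Let mtail (u : R) : measurable (tail_from u).
Proof. exact: measurable_itv. Qed.

Let mwin (u t : R) : measurable (window_to u t).
Proof. exact: measurable_itv. Qed.

Let nb : nneg_measurable (EFin \o b).
Proof. exact: nneg_measurable_slow. Qed.

Let nt := @nested_tail R.
Let nw := @nested_window R.

Lemma head_part_le u phi : nneg_measurable phi ->
  head_part u phi <= N (halfline R) (@tail_from R) phi.
Proof.
move=> n1; apply: (nested_norm_le E sa sb (m0 u) (measurable_halfline R) (nw u) nt n1 n1).
move=> t t0 _; rewrite halflineE; split; first exact: t0.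
apply: (weighted_norm_le F _ sa (mwin u t) (mtail t) n1 n1) => s _.
rewrite /window_to /tail_from/= !in_itv/= andbT => /andP[ts _]; split; first exact: ts.
exact: lexx.
Qed.

Lemma tail_part_le u phi : (0 < u)%R -> nneg_measurable phi ->
  tail_part u phi <= N (halfline R) (@tail_from R) phi.
Proof.
move=> u0 n1; apply: (nested_norm_le E sa sb (mtail u) (measurable_halfline R) nt nt n1 n1).
by move=> t t0 _; rewrite halflineE; split; [exact: t0|exact: lexx].
Qed.

(** Points are negligible. *)
Lemma tilde_norm_closed (G : ri_space R) u f : nneg_measurable f ->
  tilde_norm G `[u, +oo[ f <= tilde_norm G (tail_from u) f.
Proof.
move=> nf; rewrite -[leRHS]add0e -(tilde_norm_set1 G u nf).
apply: le_trans (tilde_normU G nf (measurable_set1 u) (mtail u)).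
have mc : measurable (`[u, +oo[ : set R) by exact: measurable_itv.
apply: (tilde_norm_le G nf nf mc (measurableU _ _ (measurable_set1 u) (mtail u))).
move=> t _; rewrite /tail_from /= !in_itv/= !andbT le_eqVlt => ut; split; last exact: lexx.
by case/predU1P : ut => [->|ut]; [left|right].
Qed.

(** The outer interval is cut at u, and for t < u so is the inner one. *)
Lemma nested_norm_le_parts u phi : (0 < u)%R -> nneg_measurable phi ->
  N (halfline R) (@tail_from R) phi <=
  head_part u phi + middle_part u phi + tail_part u phi.
Proof.
move=> u0 n1; have nn := nneg_measurable_nested F theta sa sb nt n1.
have mc : measurable (`[u, +oo[ : set R) by exact: measurable_itv.
apply: (@le_trans _ _ (N `]0%R, u[ (@tail_from R) phi + N `[u, +oo[ (@tail_from R) phi)).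
  apply: le_trans (tilde_normU E nn (m0 u) mc).
  apply: (tilde_norm_le E nn nn (measurable_halfline R) (measurableU _ _ (m0 u) mc)).
  move=> t t0 _; split; last exact: lexx.
  have [tu|ut] := ltP t u; [left|right]; rewrite /= in_itv/=.
    by rewrite t0 tu.
  by rewrite ut.
apply: leeD; last exact: tilde_norm_closed.
have W0 : 0 <= W (tail_from u) phi by exact: weighted_norm_ge0.
have Bu0 : 0 < tilde_norm E `]0%R, u[ (EFin \o b).
  by rewrite (initial_normE sb finb u0) lte_fin initial_norm_gt0.
have nWb : nneg_measurable (fun t => W (tail_from u) phi * (EFin \o b) t).
  by apply: (nneg_measurableM _ nb); exact: nneg_measurable_cst.
have nn2 := nneg_measurable_nested F theta sa sb (nw u) n1.
rewrite /middle_part -(initial_normE sb finb u0) muleC.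
apply: le_trans (leeD (lexx _) (tilde_norm_mule_le W0 nb (m0 u) Bu0)).
apply: le_trans (tilde_normD E nn2 nWb (m0 u)).
apply: (tilde_norm_le E nn (nneg_measurableD nn2 nWb) (m0 u) (m0 u)) => t t0 tu.
split; first exact: tu.
rewrite [X in _ <= _ + X]muleC -ge0_muleDr; [|exact: weighted_norm_ge0|exact: W0].
apply: lee_wpmul2l; first exact: b_ge0.
have nphi := nneg_measurable_weighted theta sa n1.
apply: (@le_trans _ _ (W (window_to u t) phi + W `[u, +oo[ phi)).
  apply: le_trans (weighted_normU F theta sa (mwin u t) mc n1).
  apply: (weighted_norm_le F _ sa (mtail t) (measurableU _ _ (mwin u t) mc) n1 n1).
  move=> s s0; rewrite /tail_from/= in_itv/= andbT => ts; split; last exact: lexx.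
  by have [su|us] := ltP s u; [left|right]; rewrite /window_to /= in_itv/= ?ts ?su ?us.
by apply: leeD; [exact: lexx|exact: tilde_norm_closed].
Qed.

(** The inner norm over (t, u) is bounded, uniformly in t, by the power at u
    because the exponent k - theta is positive. *)
Lemma head_of_power (k : R) (c : R -> R) : (theta < k)%R -> slow c ->
  exists2 C : R, (0 < C)%R & forall (D u : R) phi, (0 <= D)%R -> (0 < u)%R ->
    nneg_measurable phi ->
    (forall s, (0 < s)%R -> (s <= u)%R -> phi s <= (D * (s `^ k * c s))%:E) ->
    head_part u phi <= (C * D * (u `^ (k - theta) * (a u * c u)) * B u)%:E.
Proof.
move=> tk sc; have kt : k != theta by rewrite gt_eqF.
have [C C0 H] := weighted_norm_le_power F sa kt sc.
exists C => // D u phi D0 u0 n1 h.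
set X := (C * D * _)%R.
have au : (0 < a u)%R by case: sa => _ + _; apply.
have cu : (0 < c u)%R by case: sc => _ + _; apply.
have X0 : (0 <= X)%R by rewrite !mulr_ge0 ?powR_ge0// ltW.
rewrite EFinM -(initial_normE sb finb u0) -(tilde_normZ E X0 nb (m0 u)).
apply: (tilde_norm_le E (nneg_measurable_nested F theta sa sb (nw u) n1) _ (m0 u) (m0 u)).
  by apply: (nneg_measurableM _ nb); apply: nneg_measurable_cst; rewrite lee_fin.
move=> t t0 tu; split; first exact: tu.
rewrite muleC; apply: lee_wpmul2r; first exact: b_ge0.
have su s : window_to u t s -> (s < u)%R.
  by rewrite /window_to/= in_itv/= => /andP[].
apply: (H D u _ _ D0 u0 (mwin u t) n1) => s s0 /su/ltW su'; last exact: h.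
by rewrite mulr_ge0_le0 ?subr_ge0 ?(ltW tk)// subr_le0 ler_ln.
Qed.

Lemma middle_of_power (k : R) (c : R -> R) : (k < theta)%R -> slow c ->
  exists2 C : R, (0 < C)%R & forall (D u : R) phi, (0 <= D)%R -> (0 < u)%R ->
    nneg_measurable phi ->
    (forall s, (u <= s)%R -> phi s <= (D * (s `^ k * c s))%:E) ->
    middle_part u phi <= (C * D * (u `^ (k - theta) * (a u * c u)) * B u)%:E.
Proof.
move=> kt sc; have kt' : k != theta by rewrite lt_eqF.
have [C C0 H] := weighted_norm_le_power F sa kt' sc.
exists C => // D u phi D0 u0 n1 h.
rewrite EFinM muleC; apply: lee_wpmul2l; first by rewrite lee_fin ltW ?initial_norm_gt0.
have us s : tail_from u s -> (u < s)%R by rewrite /tail_from/= in_itv/= andbT.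
apply: (H D u _ _ D0 u0 (mtail u) n1) => s s0 /us/ltW us'; last exact: h.
by rewrite mulr_le0_ge0 ?subr_le0 ?(ltW kt)// subr_ge0 ler_ln.
Qed.

(** The inner norm is bounded by the power at t, and the outer norm of the latter
    by its value at u because k - theta is negative; finally b(u) is dominated by
    the norm of b over (0, u). *)
Lemma tail_of_power (k : R) (c : R -> R) : (k < theta)%R -> slow c ->
  exists2 C : R, (0 < C)%R & forall (D u : R) phi, (0 <= D)%R -> (0 < u)%R ->
    nneg_measurable phi ->
    (forall s, (u <= s)%R -> phi s <= (D * (s `^ k * c s))%:E) ->
    tail_part u phi <= (C * D * (u `^ (k - theta) * (a u * c u)) * B u)%:E.
Proof.
move=> kt sc; have kt' : k != theta by rewrite lt_eqF.
have [C C0 H] := weighted_norm_le_power F sa kt' sc.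
have k0 : (k - theta != 0)%R by rewrite subr_eq0.
have sacb := slowM (slowM sa sc) sb.
have [M M0 HM] := tilde_norm_power_slow_le E k0 sacb.
have [L L0 HL] := slow_le_initial_norm E sb.
exists (C * M * L)%R => [|D u phi D0 u0 n1 h]; first by rewrite !mulr_gt0.
have np := nneg_measurable_power_slow (k - theta) sacb.
have au : (0 < a u)%R by case: sa => _ + _; apply.
have cu : (0 < c u)%R by case: sc => _ + _; apply.
have CD0 : (0 <= C * D)%R by rewrite mulr_ge0// ltW.
have us s : tail_from u s -> (u < s)%R by rewrite /tail_from/= in_itv/= andbT.
apply: (@le_trans _ _ ((C * D)%:E * tilde_norm E (tail_from u)
    (fun s => (s `^ (k - theta) * (a s * c s * b s))%:E))).
  rewrite -(tilde_normZ E CD0 np (mtail u)).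
  apply: (tilde_norm_le E (nneg_measurable_nested F theta sa sb nt n1) _ (mtail u) (mtail u)).
    by apply: (nneg_measurableM _ np); apply: nneg_measurable_cst; rewrite lee_fin.
  move=> t t0 ut; split; first exact: ut.
  have := H D t (tail_from t) phi D0 t0 (mtail t) n1.
  have ts s : tail_from t s -> (t < s)%R by rewrite /tail_from/= in_itv/= andbT.
  move=> /(_ _ _)/(lee_wpmul2l (b_ge0 t0)); rewrite -!EFinM.
  have -> : (b t * (C * D * (t `^ (k - theta) * (a t * c t))) =
    C * D * (t `^ (k - theta) * (a t * c t * b t)))%R by ring.
  apply=> s s0 /ts/ltW tss.
    by rewrite mulr_le0_ge0 ?subr_le0 ?(ltW kt)// subr_ge0 ler_ln.
  by apply: h; rewrite (le_trans _ tss)// ltW// us.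
apply: (@le_trans _ _ ((C * D)%:E * (M * (u `^ (k - theta) * (a u * c u * b u)))%:E)).
  apply: lee_wpmul2l; first by rewrite lee_fin.
  apply: (HM u (tail_from u) u0 (mtail u)) => s s0 /us/ltW uss.
  by rewrite mulr_le0_ge0 ?subr_le0 ?(ltW kt)// subr_ge0 ler_ln.
have := HL u u0; rewrite (initial_normE sb finb u0) -EFinM lee_fin => bL.
rewrite -EFinM lee_fin.
have -> : (C * D * (M * (u `^ (k - theta) * (a u * c u * b u))) =
   C * M * D * (u `^ (k - theta) * (a u * c u)) * b u)%R by ring.
have -> : (C * M * L * D * (u `^ (k - theta) * (a u * c u)) * B u =
   C * M * D * (u `^ (k - theta) * (a u * c u)) * (L * B u))%R by ring.
by apply: ler_wpM2l bL; rewrite !mulr_ge0 ?powR_ge0// ltW.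
Qed.

End ThreeParts.

(** * Bounds of the nested norm by its parts *)

Section UpperParts.
Variables (R : realType) (E F : ri_space R) (theta : R) (a b : R -> R).
Hypotheses (theta0 : (0 < theta)%R) (sa : slow a) (sb : slow b).
Hypothesis finb : tilde_norm E `]0%R, 1%R[ (EFin \o b) < +oo.
Implicit Types (I : set R) (J : R -> set R) (phi psi : R -> \bar R).
Local Notation W := (weighted_norm F theta a).
Local Notation B := (initial_norm E b).
Local Notation N := (nested_norm E F theta a b).
Local Notation head := (head_part E F theta a b).
Local Notation middle := (middle_part E F theta a b).
Local Notation tail := (tail_part E F theta a b).

Let mtail (u : R) : measurable (tail_from u).
Proof. exact: measurable_itv. Qed.

Let m0 (u : R) : measurable (`]0%R, u[ : set R).
Proof. exact: measurable_itv. Qed.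

Let nneg_measurableZ (A : R) phi : (0 <= A)%R -> nneg_measurable phi ->
  nneg_measurable (fun s => A%:E * phi s).
Proof.
by move=> A0 n1; apply: (nneg_measurableM _ n1); apply: nneg_measurable_cst; rewrite lee_fin.
Qed.

Lemma head_part_leZ (A : R) u phi psi : (0 <= A)%R -> nneg_measurable phi ->
  nneg_measurable psi ->
  (forall s, (0 < s)%R -> (s <= u)%R -> psi s <= A%:E * phi s) ->
  head u psi <= A%:E * head u phi.
Proof.
move=> A0 n1 n2 h; have nA := nneg_measurableZ A0 n1.
have nw := @nested_window R u.
rewrite -(nested_normZ E F theta sa sb A0 (m0 u) nw n1).
apply: (nested_norm_le E sa sb (m0 u) (m0 u) nw nw n2 nA) => t t0 tu.
split; first exact: tu.
apply: (weighted_norm_le F _ sa (nw.1 t) (nw.1 t) n2 nA) => s s0 ws.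
split; first exact: ws.
by apply: h => //; move: ws; rewrite /window_to/= in_itv/= => /andP[_ /ltW].
Qed.

Lemma middle_part_leZ (A : R) u phi psi : (0 <= A)%R -> (0 < u)%R ->
  nneg_measurable phi -> nneg_measurable psi ->
  (forall s, (u <= s)%R -> psi s <= A%:E * phi s) ->
  middle u psi <= A%:E * middle u phi.
Proof.
move=> A0 u0 n1 n2 h; have nA := nneg_measurableZ A0 n1.
rewrite /middle_part muleCA; apply: lee_wpmul2l.
  by rewrite lee_fin ltW ?initial_norm_gt0.
rewrite -(weighted_normZ F theta sa A0 (mtail u) n1).
apply: (weighted_norm_le F _ sa (mtail u) (mtail u) n2 nA) => s s0 us.
split; first exact: us.
by apply: h; move: us; rewrite /tail_from/= in_itv/= andbT => /ltW.
Qed.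

Lemma tail_part_leZ (A : R) u phi psi : (0 <= A)%R ->
  nneg_measurable phi -> nneg_measurable psi ->
  (forall s, (u <= s)%R -> psi s <= A%:E * phi s) ->
  tail u psi <= A%:E * tail u phi.
Proof.
move=> A0 n1 n2 h; have nA := nneg_measurableZ A0 n1.
have nt := @nested_tail R.
rewrite -(nested_normZ E F theta sa sb A0 (mtail u) nt n1).
apply: (nested_norm_le E sa sb (mtail u) (mtail u) nt nt n2 nA) => t t0 ut.
split; first exact: ut.
apply: (weighted_norm_le F _ sa (nt.1 t) (nt.1 t) n2 nA) => s s0 ts.
split; first exact: ts.
apply: h; move: ut ts; rewrite /tail_from/= !in_itv/= !andbT => ut ts.
exact/ltW/(lt_trans ut ts).
Qed.

(** Above u, psi is only known to be bounded, that is dominated by the power of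
    exponent 0, which is less than theta. *)
Lemma nested_norm_le_head : exists2 C : R, (0 < C)%R &
  forall (u A k : R) phi psi, (0 < u)%R -> (0 <= A)%R -> (0 <= k)%R ->
    nneg_measurable phi -> nneg_measurable psi ->
    (forall s, (0 < s)%R -> (s <= u)%R -> psi s <= A%:E * phi s) ->
    (forall s, (u <= s)%R -> psi s <= k%:E) ->
    N (halfline R) (@tail_from R) psi <=
      A%:E * head u phi + (C * k * (u `^ (- theta) * a u * B u))%:E.
Proof.
have [C C0 HC] := middle_of_power F sa sb finb theta0 (slow1 R).
have [D D0 HD] := tail_of_power F sa sb finb theta0 (slow1 R).
exists (C + D)%R => [|u A k phi psi u0 A0 k0 n1 n2 h1 h2]; first exact: addr_gt0.
have h2' s : (u <= s)%R -> psi s <= (k * (s `^ 0 * 1))%:E.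
  by move=> us; rewrite powRr0 !mulr1; exact: h2.
apply: le_trans (nested_norm_le_parts F theta sa sb finb u0 n2) _.
rewrite -addeA; apply: leeD; first exact: head_part_leZ.
apply: le_trans (leeD (HC k u psi k0 u0 n2 h2') (HD k u psi k0 u0 n2 h2')) _.
rewrite -EFinD lee_fin sub0r mulr1 le_eqVlt; apply/orP; left; apply/eqP; ring.
Qed.

(** Below u, psi is dominated by the power of exponent 1, which is greater than
    theta. *)
Lemma nested_norm_le_tail : (theta < 1)%R -> exists2 C : R, (0 < C)%R &
  forall (u A D : R) phi psi, (0 < u)%R -> (0 <= A)%R -> (0 <= D)%R ->
    nneg_measurable phi -> nneg_measurable psi ->
    (forall s, (u <= s)%R -> psi s <= A%:E * phi s) ->
    (forall s, (0 < s)%R -> (s <= u)%R -> psi s <= (D * s)%:E) ->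
    N (halfline R) (@tail_from R) psi <=
      (C * D * (u `^ (1 - theta) * a u * B u))%:E +
      A%:E * middle u phi + A%:E * tail u phi.
Proof.
move=> theta1; have [C C0 HC] := head_of_power F sa sb finb theta1 (slow1 R).
exists C => // u A D phi psi u0 A0 D0 n1 n2 h1 h2.
have h2' s : (0 < s)%R -> (s <= u)%R -> psi s <= (D * (s `^ 1 * 1))%:E.
  by move=> s0 su; rewrite (powRr1 (ltW s0)) mulr1; exact: h2.
apply: le_trans (nested_norm_le_parts F theta sa sb finb u0 n2) _.
apply: leeD; last exact: tail_part_leZ.
apply: leeD; last exact: middle_part_leZ.
apply: le_trans (HC D u psi D0 u0 n2 h2') _.
rewrite lee_fin mulr1 le_eqVlt; apply/orP; left; apply/eqP; ring.
Qed.

Lemma nested_norm_eq0 phi : nneg_measurable phi ->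
  (forall s, (0 < s)%R -> phi s = 0) -> N (halfline R) (@tail_from R) phi = 0.
Proof.
move=> n1 h; have nt := @nested_tail R; have mH := measurable_halfline R.
apply/le_anti/andP; split; last exact: nested_norm_ge0.
have nA := nneg_measurableZ (lexx 0%R) n1.
rewrite -(mul0e (N (halfline R) (@tail_from R) phi)).
rewrite -(nested_normZ E F theta sa sb (lexx 0%R) mH nt n1).
apply: (nested_norm_le E sa sb mH mH nt nt n1 nA) => t t0 Ht; split; first exact: Ht.
apply: (weighted_norm_le F _ sa (nt.1 t) (nt.1 t) n1 nA) => s s0 ts.
by split; [exact: ts|rewrite h// mule0].
Qed.

End UpperParts.

(** * The K-functional of the original couple *)

Section KFunctional.
Variables (R : realType) (V : lmodType R) (X0 X1 : qspace V).
Hypotheses (qX0 : quasi_banach X0) (qX1 : quasi_banach X1).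
Implicit Types (f g : V) (s t u : R).
Local Notation K := (Kfun X0 X1).

Lemma qnormN (X : qspace V) x : quasi_banach X -> qcarrier X x ->
  qcarrier X (- x)%R /\ qnorm X (- x)%R = qnorm X x.
Proof.
move=> qX Xx; rewrite -scaleN1r; split; first exact: (qbZ qX).
by rewrite (qb_normZ qX)// normrN1 mul1e.
Qed.

Lemma qnorm0 (X : qspace V) : quasi_banach X -> qcarrier X 0%R /\ qnorm X 0%R = 0.
Proof. by move=> qX; have X00 := qb0 qX; split=> //; apply/(qb_norm_eq0 qX). Qed.

Lemma Kfun_le t f0 f1 : qcarrier X0 f0 -> qcarrier X1 f1 ->
  K t (f0 + f1)%R <= qnorm X0 f0 + t%:E * qnorm X1 f1.
Proof. by move=> c0 c1; apply: ereal_inf_lbound; exists f0, f1. Qed.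

Lemma Kfun_le_qnorm0 t f : qcarrier X0 f -> K t f <= qnorm X0 f.
Proof.
move=> cf; have [c0 n0] := qnorm0 qX1.
by have := Kfun_le t cf c0; rewrite addr0 n0 mule0 adde0.
Qed.

Lemma Kfun_le_qnorm1 t f : qcarrier X1 f -> K t f <= t%:E * qnorm X1 f.
Proof.
move=> cf; have [c0 n0] := qnorm0 qX0.
by have := Kfun_le t c0 cf; rewrite add0r n0 add0e.
Qed.

Lemma Kfun_nneg_nondecreasing f : nneg_nondecreasing (fun t => K t f).
Proof.
split=> [t t0|s t s0 st]; apply: le_ereal_inf_tmp => _ [f0 [f1 [c0 c1 fE ->]]].
  rewrite adde_ge0 ?mule_ge0 ?(qb_norm_ge0 qX0) ?(qb_norm_ge0 qX1)//.
  by rewrite lee_fin ltW.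
rewrite fE; apply: le_trans (Kfun_le _ c0 c1) _.
by rewrite leeD2l// lee_wpmul2r ?lee_fin ?(qb_norm_ge0 qX1).
Qed.

Lemma qsumD f g : qsum X0 X1 f -> qsum X0 X1 g -> qsum X0 X1 (f + g)%R.
Proof.
move=> [f0 [f1 [cf0 cf1 ->]]] [g0 [g1 [cg0 cg1 ->]]].
exists (f0 + g0)%R, (f1 + g1)%R; split; [exact: (qbD qX0)|exact: (qbD qX1)|].
by rewrite addrACA.
Qed.

Lemma qsum_l f : qcarrier X0 f -> qsum X0 X1 f.
Proof. by move=> c; exists f, 0%R; rewrite addr0; split=> //; exact: (qb0 qX1). Qed.

Lemma qsum_r f : qcarrier X1 f -> qsum X0 X1 f.
Proof. by move=> c; exists 0%R, f; rewrite add0r; split=> //; exact: (qb0 qX0). Qed.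

Lemma Kfun_fin_num t f : (0 < t)%R -> qsum X0 X1 f -> K t f \is a fin_num.
Proof.
move=> t0 [f0 [f1 [c0 c1 ->]]].
rewrite ge0_fin_numE; last exact: (Kfun_nneg_nondecreasing _).1.
apply: le_lt_trans (Kfun_le _ c0 c1) _.
have := qb_fin_num qX0 c0; have := qb_fin_num qX1 c1.
by move=> /fineK <- /fineK <-; rewrite -EFinM -EFinD ltry.
Qed.

Lemma Kfun_scale s u f : (0 < s)%R -> (s <= u)%R -> (s / u)%:E * K u f <= K s f.
Proof.
move=> s0 su; have u0 : (0 < u)%R by exact: lt_le_trans su.
have su0 : (0 <= s / u)%R by rewrite divr_ge0// ltW.
apply: le_ereal_inf_tmp => _ [f0 [f1 [c0 c1 fE ->]]].
rewrite fE; apply: le_trans (lee_wpmul2l _ (Kfun_le _ c0 c1)) _.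
  by rewrite lee_fin.
have := qb_norm_ge0 qX0 c0; have := qb_fin_num qX0 c0; have := qb_fin_num qX1 c1.
move=> /fineK <- /fineK <-; rewrite -?EFinM -?EFinD -?EFinM !lee_fin => n0.
rewrite mulrDr mulrA divfK ?(gt_eqF u0)// lerD2r ler_piMl//.
by rewrite ler_pdivrMr// mul1r.
Qed.

Lemma Kfun_lt t f (x : \bar R) : K t f < x ->
  exists f0 f1, [/\ qcarrier X0 f0, qcarrier X1 f1, f = (f0 + f1)%R &
    qnorm X0 f0 + t%:E * qnorm X1 f1 < x].
Proof. by move=> /ereal_inf_lt[_ [f0 [f1 [c0 c1 fE ->]]] lt]; exists f0, f1. Qed.

(** Adding decompositions of f and g gives one of f + g. *)
Lemma Kfun_quasi_subadditive : exists2 Q : R, (1 <= Q)%R &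
  forall s f g, (0 < s)%R -> qsum X0 X1 f -> qsum X0 X1 g ->
    K s (f + g)%R <= Q%:E * (K s f + K s g).
Proof.
have [C0 HC0] := qb_normD qX0; have [C1 HC1] := qb_normD qX1.
exists (1 + `|C0| + `|C1|)%R => [|s f g s0 sf sg].
  by rewrite -addrA lerDl addr_ge0.
set Q := (1 + _ + _)%R; have Q0 : (0 < Q)%R.
  by rewrite /Q -addrA ltr_pwDl// addr_ge0.
have QC0 : (C0 <= Q)%R.
  by rewrite (le_trans (ler_norm _))// /Q addrAC lerDr addr_ge0.
have QC1 : (C1 <= Q)%R by rewrite (le_trans (ler_norm _))// /Q lerDr addr_ge0.
have le_sum f0 f1 g0 g1 : qcarrier X0 f0 -> qcarrier X1 f1 ->
    qcarrier X0 g0 -> qcarrier X1 g1 ->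
    K s ((f0 + f1) + (g0 + g1))%R <= Q%:E *
      ((qnorm X0 f0 + s%:E * qnorm X1 f1) + (qnorm X0 g0 + s%:E * qnorm X1 g1)).
  move=> cf0 cf1 cg0 cg1.
  rewrite addrACA; apply: le_trans (Kfun_le _ (qbD qX0 cf0 cg0) (qbD qX1 cf1 cg1)) _.
  apply: le_trans (leeD (HC0 _ _ cf0 cg0) (lee_wpmul2l _ (HC1 _ _ cf1 cg1))) _.
    by rewrite lee_fin ltW.
  have := qb_norm_ge0 qX0 cf0; have := qb_norm_ge0 qX0 cg0.
  have := qb_norm_ge0 qX1 cf1; have := qb_norm_ge0 qX1 cg1.
  have := qb_fin_num qX0 cf0; have := qb_fin_num qX0 cg0.
  have := qb_fin_num qX1 cf1; have := qb_fin_num qX1 cg1.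
  move=> /fineK <- /fineK <- /fineK <- /fineK <-.
  rewrite -?EFinM -?EFinD -?EFinM -?EFinD -?EFinM !lee_fin => p1 p2 p3 p4.
  have -> : forall a b c d : R, (Q * (a + s * b + (c + s * d)) =
    Q * (a + c) + s * (Q * (b + d)))%R by move=> *; ring.
  by rewrite lerD// ?ler_pM2l// ler_wpM2r// addr_ge0.
have /fineK eB := Kfun_fin_num s0 sf; have /fineK eC := Kfun_fin_num s0 sg.
have /fineK eA := Kfun_fin_num s0 (qsumD sf sg).
set r := fine _ in eA; set p := fine _ in eB; set q := fine _ in eC.
rewrite -eA -eB -eC -EFinD -EFinM lee_fin leNgt; apply/negP => lt.
(* Half of the gap left for each of f and g if the inequality failed. *)
pose d := ((r / Q - p - q) / 2)%R.
have d0 : (0 < d)%R.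
  by rewrite /d divr_gt0// -addrA -opprD subr_gt0 ltr_pdivlMr// mulrC.
have /Kfun_lt[f0 [f1 [cf0 cf1 fE fp]]] : K s f < (p + d)%:E.
  by rewrite -eB lte_fin ltrDl.
have /Kfun_lt[g0 [g1 [cg0 cg1 gE gq]]] : K s g < (q + d)%:E.
  by rewrite -eC lte_fin ltrDl.
have := le_sum _ _ _ _ cf0 cf1 cg0 cg1.
rewrite -fE -gE -eA leNgt => /negP; apply.
have QE : (Q * ((p + d) + (q + d)) = r)%R by rewrite /d; field; rewrite gt_eqF.
by rewrite -QE EFinM lte_pmul2l// EFinD lteD.
Qed.

End KFunctional.

(** * Both norms against the three parts *)

Section ErealArithmetic.
Variable R : realType.
Implicit Types h m t p q : \bar R.

Lemma three_terms_distr (Q r : R) h0 h1 m0 m1 t0 t1 : (0 <= Q)%R -> (0 <= r)%R ->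
  0 <= h0 -> 0 <= h1 -> 0 <= m0 -> 0 <= m1 -> 0 <= t0 -> 0 <= t1 ->
  Q%:E * (h0 + h1) + r%:E * (Q%:E * (m0 + m1)) + r%:E * (Q%:E * (t0 + t1)) =
  Q%:E * ((h0 + r%:E * m0 + r%:E * t0) + (h1 + r%:E * m1 + r%:E * t1)).
Proof.
rewrite -!lee_fin => Q0 r0 h00 h10 m00 m10 t00 t10.
rewrite (muleCA r%:E Q%:E (m0 + m1)) (muleCA r%:E Q%:E (t0 + t1)).
have M0 : 0 <= r%:E * m0 by exact: mule_ge0.
have M1 : 0 <= r%:E * m1 by exact: mule_ge0.
have T0 : 0 <= r%:E * t0 by exact: mule_ge0.
have T1 : 0 <= r%:E * t1 by exact: mule_ge0.
rewrite (ge0_muleDr r%:E m00 m10) (ge0_muleDr r%:E t00 t10).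
rewrite -(ge0_muleDr Q%:E (adde_ge0 h00 h10) (adde_ge0 M0 M1)) addeACA.
have S0 := adde_ge0 (adde_ge0 h00 M0) (adde_ge0 h10 M1).
rewrite -(ge0_muleDr Q%:E S0 (adde_ge0 T0 T1)); congr (Q%:E * _).
exact: addeACA.
Qed.

Lemma upper_bound_arithmetic (A X r C D L : R) h m t p q :
  (0 <= A)%R -> (0 < r)%R -> (0 < C)%R -> (0 < D)%R -> (0 < L)%R ->
  0 <= h -> 0 <= m -> 0 <= t ->
  X%:E <= L%:E * m -> p <= A%:E * h + (2 * C * (r * X))%:E ->
  q <= (2 * D * X)%:E + A%:E * m + A%:E * t ->
  p + r%:E * q <= (A + 2 * (C + D) * L)%:E * (h + r%:E * m + r%:E * t).
Proof.
move=> A0 r0 C0 D0 L0 h0 m0 t0 XL ph qm.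
have c0 : (0 < A + 2 * (C + D) * L)%R by rewrite ltr_wpDl// !mulr_gt0// addr_gt0.
have r0' : 0 <= r%:E by rewrite lee_fin ltW.
apply: le_trans (leeD ph (lee_wpmul2l r0' qm)) _ => {p q ph qm}.
have rm0 : 0 <= r%:E * m by exact: mule_ge0.
have rt0 : 0 <= r%:E * t by exact: mule_ge0.
have rfin x : 0 <= x -> r%:E * x < +oo -> x \is a fin_num.
  by case: x => [x| |]//= _; rewrite gt0_muley ?lte_fin.
have [->|] := eqVneq (h + r%:E * m + r%:E * t) +oo.
  by rewrite gt0_muley ?leey ?lte_fin.
rewrite -ltey => fin.
have hfin : h \is a fin_num.
  rewrite ge0_fin_numE//; apply: le_lt_trans fin.
  by rewrite -addeA leeDl// adde_ge0.
have mfin : m \is a fin_num.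
  apply: rfin => //; apply: le_lt_trans fin.
  by rewrite -addeA addeCA leeDl// adde_ge0.
have tfin : t \is a fin_num.
  by apply: rfin => //; apply: le_lt_trans fin; rewrite leeDr// adde_ge0.
move: h0 m0 t0 XL; move: hfin mfin tfin => {rm0 rt0 fin} /fineK <- /fineK <- /fineK <-.
move: (fine h) (fine m) (fine t) => {}h {}m {}t.
rewrite -?EFinM -?EFinD -?EFinM -?EFinD !lee_fin => h0 m0 t0 XL.
have : (2 * (C + D) * (r * X) <= 2 * (C + D) * (r * (L * m)))%R.
  by rewrite ler_pM2l ?mulr_gt0 ?addr_gt0// ler_pM2l.
have : (0 <= (2 * (C + D) * L) * (h + r * t))%R.
  by rewrite !mulr_ge0 ?addr_ge0 ?mulr_ge0// ltW.
lra.
Qed.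

End ErealArithmetic.

Section Parts.
Variables (R : realType) (theta0 theta1 : R) (E0 E1 F0 F1 : ri_space R).
Variables (a0 a1 b0 b1 : R -> R).
Hypotheses (theta0_gt0 : (0 < theta0)%R) (theta01 : (theta0 < theta1)%R).
Hypothesis theta1_lt1 : (theta1 < 1)%R.
Hypotheses (sa0 : slow a0) (sa1 : slow a1) (sb0 : slow b0) (sb1 : slow b1).
Hypothesis finb0 : tilde_norm E0 `]0%R, 1%R[ (EFin \o b0) < +oo.
Hypothesis finb1 : tilde_norm E1 `]0%R, 1%R[ (EFin \o b1) < +oo.
Implicit Types (phi psi : R -> \bar R) (u : R).
Local Notation B0 := (initial_norm E0 b0).
Local Notation B1 := (initial_norm E1 b1).
Local Notation r := (rho theta0 theta1 a0 a1 b0 b1 E0 E1).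
Local Notation N0 := (nested_norm E0 F0 theta0 a0 b0 (halfline R) (@tail_from R)).
Local Notation N1 := (nested_norm E1 F1 theta1 a1 b1 (halfline R) (@tail_from R)).
Local Notation head := (head_part E0 F0 theta0 a0 b0).
Local Notation middle := (middle_part E1 F1 theta1 a1 b1).
Local Notation tail := (tail_part E1 F1 theta1 a1 b1).

Definition three_parts u phi : \bar R :=
  head u phi + (r u)%:E * middle u phi + (r u)%:E * tail u phi.

Let B0_gt0 u : (0 < u)%R -> (0 < B0 u)%R.
Proof. exact: initial_norm_gt0. Qed.

Let B1_gt0 u : (0 < u)%R -> (0 < B1 u)%R.
Proof. exact: initial_norm_gt0. Qed.

Let a0_gt0 u : (0 < u)%R -> (0 < a0 u)%R.
Proof. by case: sa0 => _ + _; apply. Qed.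

Let a1_gt0 u : (0 < u)%R -> (0 < a1 u)%R.
Proof. by case: sa1 => _ + _; apply. Qed.

Lemma rho_gt0 u : (0 < u)%R -> (0 < r u)%R.
Proof.
move=> u0; rewrite /rho -/(B0 u) -/(B1 u).
by rewrite mulr_gt0 ?powR_gt0// divr_gt0// mulr_gt0 ?B0_gt0 ?B1_gt0 ?a0_gt0 ?a1_gt0.
Qed.

(** This is where the form of rho comes from: it equates the remainders left by
    the two halves of a nearly optimal decomposition. *)
Lemma rho_balance u : (0 < u)%R ->
  (u `^ (- theta0) * a0 u * B0 u = r u * (u `^ (- theta1) * a1 u * B1 u))%R.
Proof.
move=> u0; rewrite /rho -/(B0 u) -/(B1 u) !(powR_gt0E _ u0).
have -> : (- theta0 * ln u = (theta1 - theta0) * ln u + - theta1 * ln u)%R by ring.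
by rewrite expRD; field; rewrite !gt_eqF ?a1_gt0 ?B1_gt0.
Qed.

Let mtail (u : R) : measurable (tail_from u).
Proof. exact: measurable_itv. Qed.

Let m0 (u : R) : measurable (`]0%R, u[ : set R).
Proof. exact: measurable_itv. Qed.

Let nt := @nested_tail R.
Let nw := @nested_window R.

Let head_ge0 u phi : nneg_measurable phi -> 0 <= head u phi.
Proof. by move=> n; exact: (nested_norm_ge0 E0 F0 theta0 sa0 sb0 (m0 u) (nw u) n). Qed.

Let tail_ge0 u phi : nneg_measurable phi -> 0 <= tail u phi.
Proof. by move=> n; exact: (nested_norm_ge0 E1 F1 theta1 sa1 sb1 (mtail u) nt n). Qed.

Let middle_ge0 u phi : (0 < u)%R -> nneg_measurable phi -> 0 <= middle u phi.
Proof.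
move=> u0 n; apply: mule_ge0; first by rewrite lee_fin ltW ?B1_gt0.
exact: (weighted_norm_ge0 F1 theta1 sa1 (mtail u) n).
Qed.

Lemma three_parts_ge0 u phi : (0 < u)%R -> nneg_measurable phi -> 0 <= three_parts u phi.
Proof.
move=> u0 n; have r0 : 0 <= (r u)%:E by rewrite lee_fin ltW ?rho_gt0.
apply: adde_ge0; last by apply: mule_ge0 => //; exact: tail_ge0.
by apply: adde_ge0; [exact: head_ge0|apply: mule_ge0 => //; exact: middle_ge0].
Qed.

Lemma three_parts_quasi (Q : R) u phi phi0 phi1 : (0 <= Q)%R -> (0 < u)%R ->
  nneg_measurable phi -> nneg_measurable phi0 -> nneg_measurable phi1 ->
  (forall s, (0 < s)%R -> phi s <= Q%:E * (phi0 s + phi1 s)) ->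
  three_parts u phi <= Q%:E * (three_parts u phi0 + three_parts u phi1).
Proof.
move=> Q0 u0 n n0 n1 h.
have r0 : 0 <= (r u)%:E by rewrite lee_fin ltW ?rho_gt0.
have n01 := nneg_measurableD n0 n1.
have hd : head u phi <= Q%:E * (head u phi0 + head u phi1).
  exact: (nested_norm_quasi E0 F0 theta0 sa0 sb0 Q0 (m0 u) (nw u) n n0 n1 h).
have tl : tail u phi <= Q%:E * (tail u phi0 + tail u phi1).
  exact: (nested_norm_quasi E1 F1 theta1 sa1 sb1 Q0 (mtail u) nt n n0 n1 h).
have md : middle u phi <= Q%:E * (middle u phi0 + middle u phi1).
  have h' s : (u <= s)%R -> phi s <= Q%:E * (phi0 s + phi1 s).
    by move=> us; apply: h; exact: lt_le_trans us.
  apply: le_trans (middle_part_leZ F1 theta1 sa1 sb1 finb1 Q0 u0 n01 n h') _.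
  apply: lee_wpmul2l; first by rewrite lee_fin.
  rewrite /middle_part -ge0_muleDr; last 2 first.
  - exact: (weighted_norm_ge0 F1 theta1 sa1 (mtail u) n0).
  - exact: (weighted_norm_ge0 F1 theta1 sa1 (mtail u) n1).
  apply: lee_wpmul2l; first by rewrite lee_fin ltW ?B1_gt0.
  exact: (weighted_normD F1 theta1 sa1 (mtail u) n0 n1).
have H0 := head_ge0 u n0; have H1 := head_ge0 u n1.
have M0 := middle_ge0 u0 n0; have M1 := middle_ge0 u0 n1.
have T0 := tail_ge0 u n0; have T1 := tail_ge0 u n1.
apply: (@le_trans _ _ (Q%:E * (head u phi0 + head u phi1) +
   (r u)%:E * (Q%:E * (middle u phi0 + middle u phi1)) +
   (r u)%:E * (Q%:E * (tail u phi0 + tail u phi1)))).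
  by apply: leeD; [apply: leeD => //|]; exact: lee_wpmul2l.
by rewrite (three_terms_distr Q0 (ltW (rho_gt0 u0)) H0 H1 M0 M1 T0 T1) lexx.
Qed.

(** The head of phi is a part of its norm in the first space. The other parts are
    norms in the second space, and they are computed from the pointwise bound by
    a power of exponent theta0 < theta1 times a slow function; rho cancels the
    result exactly. *)
Lemma three_parts_le0 : exists2 C : R, (0 < C)%R & forall u (n : R) phi,
  (0 < u)%R -> (0 <= n)%R -> nneg_nondecreasing phi -> N0 phi = n%:E ->
  three_parts u phi <= (C * n)%:E.
Proof.
have [C C0 HC] := nested_norm_ge_value F0 theta0 sa0 sb0 finb0.
have sc : slow (fun t => (a0 t * B0 t)^-1)%R.
  exact: (slowV (slowM sa0 (initial_norm_slow sb0 finb0))).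
have [D D0 HD] := middle_of_power F1 sa1 sb1 finb1 theta01 sc.
have [L L0 HL] := tail_of_power F1 sa1 sb1 finb1 theta01 sc.
exists (1 + D * C + L * C)%R => [|u n phi u0 n0 nphi nE].
  by rewrite !addr_gt0// mulr_gt0.
have nn := nneg_nondecreasing_measurable nphi.
have Cn : (0 <= C * n)%R by rewrite mulr_ge0// ltW.
have h s : (u <= s)%R -> phi s <= (C * n * (s `^ theta0 * (a0 s * B0 s)^-1))%:E.
  by move=> us; apply: HC => //; exact: lt_le_trans us.
have r0 : 0 <= (r u)%:E by rewrite lee_fin ltW ?rho_gt0.
have rE : (r u * (u `^ (theta0 - theta1) * (a1 u * (a0 u * B0 u)^-1) * B1 u) = 1)%R.
  rewrite /rho -/(B0 u) -/(B1 u).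
  have -> : (u `^ (theta0 - theta1) = (u `^ (theta1 - theta0))^-1)%R.
    by rewrite -powRN opprB.
  by field; rewrite !gt_eqF ?a1_gt0 ?B1_gt0 ?a0_gt0 ?B0_gt0 ?powR_gt0.
have -> : ((1 + D * C + L * C) * n =
  n + r u * (D * (C * n) * (u `^ (theta0 - theta1) * (a1 u * (a0 u * B0 u)^-1)) * B1 u) +
  r u * (L * (C * n) * (u `^ (theta0 - theta1) * (a1 u * (a0 u * B0 u)^-1)) * B1 u))%R.
  set y := (_ * (a1 u * _))%R in rE *; rewrite [RHS](_ : _ =
    n + D * C * n * (r u * (y * B1 u)) + L * C * n * (r u * (y * B1 u)))%R; last by ring.
  by rewrite rE; ring.
rewrite !EFinD !(EFinM (r u)); apply: leeD.
  apply: leeD.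
    by rewrite -nE; exact: (head_part_le E0 F0 theta0 sa0 sb0 u nn).
  by apply: lee_wpmul2l => //; exact: (HD _ u phi Cn u0 nn h).
by apply: lee_wpmul2l => //; exact: (HL _ u phi Cn u0 nn h).
Qed.

(** The middle and the tail are parts of the norm in the second space, and the
    head is computed from the pointwise bound by a power of exponent
    theta1 > theta0 times a slow function. *)
Lemma three_parts_le1 : exists2 C : R, (0 < C)%R & forall u (n : R) phi,
  (0 < u)%R -> (0 <= n)%R -> nneg_nondecreasing phi -> N1 phi = n%:E ->
  three_parts u phi <= (C * (r u * n))%:E.
Proof.
have [C C0 HC] := nested_norm_ge_value F1 theta1 sa1 sb1 finb1.
have sc : slow (fun t => (a1 t * B1 t)^-1)%R.
  exact: (slowV (slowM sa1 (initial_norm_slow sb1 finb1))).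
have [D D0 HD] := head_of_power F0 sa0 sb0 finb0 theta01 sc.
exists (D * C + 1 + 1)%R => [|u n phi u0 n0 nphi nE].
  by rewrite !addr_gt0// mulr_gt0.
have nn := nneg_nondecreasing_measurable nphi.
have Cn : (0 <= C * n)%R by rewrite mulr_ge0// ltW.
have h s : (0 < s)%R -> (s <= u)%R ->
    phi s <= (C * n * (s `^ theta1 * (a1 s * B1 s)^-1))%:E.
  by move=> s0 _; exact: HC.
have r0 : 0 <= (r u)%:E by rewrite lee_fin ltW ?rho_gt0.
have -> : ((D * C + 1 + 1) * (r u * n) =
  D * (C * n) * (u `^ (theta1 - theta0) * (a0 u * (a1 u * B1 u)^-1)) * B0 u +
  r u * n + r u * n)%R.
  rewrite /rho -/(B0 u) -/(B1 u).
  by field; rewrite !gt_eqF ?a1_gt0 ?B1_gt0.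
rewrite !EFinD !(EFinM (r u)); apply: leeD.
  apply: leeD; first exact: (HD _ u phi Cn u0 nn h).
  apply: lee_wpmul2l => //; rewrite -nE.
  exact: (tail_le_nested_norm F1 theta1 sa1 sb1 finb1 u0 nn).
apply: lee_wpmul2l => //; rewrite -nE.
exact: (tail_part_le E1 F1 theta1 sa1 sb1 u0 nn).
Qed.

(** Here psi0 and psi1 stand for the K-functionals of the two halves of a
    decomposition of f that is optimal at u up to a factor 2, and phi for that of
    f. The terms in k = K(u, f) produced by the two norms agree by [rho_balance]
    and are controlled by the middle part, since K(u, f) bounds K(s, f) from below
    for s > u. *)
Lemma nested_norms_le_three_parts (A : R) : (0 <= A)%R ->
  exists2 C : R, (0 < C)%R & forall u (k : R) phi psi0 psi1,
  (0 < u)%R -> (0 <= k)%R -> nneg_nondecreasing phi -> phi u = k%:E ->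
  nneg_measurable psi0 -> nneg_measurable psi1 ->
  (forall s, (0 < s)%R -> (s <= u)%R -> psi0 s <= A%:E * phi s) ->
  (forall s, (u <= s)%R -> psi0 s <= (2 * k)%:E) ->
  (forall s, (u <= s)%R -> psi1 s <= A%:E * phi s) ->
  (forall s, (0 < s)%R -> (s <= u)%R -> psi1 s <= (2 * k / u * s)%:E) ->
  N0 psi0 + (r u)%:E * N1 psi1 <= C%:E * three_parts u phi.
Proof.
move=> A0.
have [C C0 HC] := nested_norm_le_head F0 theta0_gt0 sa0 sb0 finb0.
have [D D0 HD] := nested_norm_le_tail F1 sa1 sb1 finb1 theta1_lt1.
have [L L0 HL] := weighted_norm_ge_value F1 theta1 sa1.
have c0 : (0 < A + 2 * (C + D) * L)%R.
  by rewrite ltr_wpDl// !mulr_gt0// addr_gt0.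
exists (A + 2 * (C + D) * L)%R => // u k phi psi0 psi1 u0 k0 nphi phiu n0 n1 h0 h0' h1 h1'.
have nn := nneg_nondecreasing_measurable nphi.
have r0 := rho_gt0 u0.
have Hh := head_ge0 u nn; have Hm := middle_ge0 u0 nn; have Ht := tail_ge0 u nn.
have k2 : (0 <= 2 * k)%R by rewrite mulr_ge0.
have k2u : (0 <= 2 * k / u)%R by rewrite divr_ge0// ltW.
have Bu := B1_gt0 u0.
pose X := (k * (u `^ (- theta1) * a1 u) * B1 u)%R.
have XL : X%:E <= L%:E * middle u phi.
  rewrite /middle_part muleCA /X mulrC EFinM; apply: lee_wpmul2l.
    by rewrite lee_fin ltW.
  by rewrite EFinM -phiu; exact: (HL u phi u0 nphi).
have ph := HC u A (2 * k)%R phi psi0 u0 A0 k2 nn n0 h0 h0'.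
have qm := HD u A (2 * k / u)%R phi psi1 u0 A0 k2u nn n1 h1 h1'.
apply: (upper_bound_arithmetic A0 r0 C0 D0 L0 Hh Hm Ht XL).
- have <- // : (C * (2 * k) * (u `^ (- theta0) * a0 u * B0 u) = 2 * C * (r u * X))%R.
  by rewrite (rho_balance u0) /X; ring.
- have <- // : (D * (2 * k / u) * (u `^ (1 - theta1) * a1 u * B1 u) = 2 * D * X)%R.
  rewrite /X !(powR_gt0E _ u0).
  have -> : ((1 - theta1) * ln u = ln u + - theta1 * ln u)%R by ring.
  by rewrite expRD lnK ?posrE//; field; rewrite gt_eqF.
Qed.

End Parts.

(** * The equivalence *)

Theorem theorem3p1 (R : realType) (V : topologicalLmodType R)
    (X0 X1 : qspace V) (theta0 theta1 : R)
    (E0 E1 F0 F1 : ri_space R) (a0 a1 b0 b1 : R -> R) :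
  compatible_couple X0 X1 ->
  (0 < theta0)%R -> (theta0 < theta1)%R -> (theta1 < 1)%R ->
  slowly_varying a0 -> slowly_varying a1 ->
  slowly_varying b0 -> slowly_varying b1 ->
  tilde_norm E0 `]0%R, 1%R[ (EFin \o b0) < +oo ->
  tilde_norm E1 `]0%R, 1%R[ (EFin \o b1) < +oo ->
  let Y0 := Rspace X0 X1 theta0 b0 E0 a0 F0 in
  let Y1 := Rspace X0 X1 theta1 b1 E1 a1 F1 in
  let rho := rho theta0 theta1 a0 a1 b0 b1 E0 E1 in
  let rhs (u : R) (f : V) :=
    tilde_norm E0 `]0%R, u[
      (fun t => (b0 t)%:E * K_norm X0 X1 theta0 a0 F0 `]t, u[ f)
    + (rho u)%:E * tilde_norm E1 `]0%R, u[ (EFin \o b1)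
        * K_norm X0 X1 theta1 a1 F1 `]u, +oo[ f
    + (rho u)%:E * tilde_norm E1 `]u, +oo[
        (fun t => (b1 t)%:E * K_norm X0 X1 theta1 a1 F1 `]t, +oo[ f) in
  exists2 c : R, (0 < c)%R &
    forall (f : V) (u : R), qsum Y0 Y1 f -> (0 < u)%R ->
      Kfun Y0 Y1 (rho u) f <= c%:E * rhs u f /\
      rhs u f <= c%:E * Kfun Y0 Y1 (rho u) f.
Proof.
move=> [_ qX0 qX1 _ _] t0 t01 t1 va0 va1 vb0 vb1 fb0 fb1 Y0 Y1 r rhs.
have sa0 := slowly_varying_slow va0; have sa1 := slowly_varying_slow va1.
have sb0 := slowly_varying_slow vb0; have sb1 := slowly_varying_slow vb1.
pose K f s := Kfun X0 X1 s f.
pose N0 := nested_norm E0 F0 theta0 a0 b0 (halfline R) (@tail_from R).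
pose N1 := nested_norm E1 F1 theta1 a1 b1 (halfline R) (@tail_from R).
pose P u phi := three_parts theta0 theta1 E0 E1 F0 F1 a0 a1 b0 b1 u phi.
have rhsE u f : (0 < u)%R -> rhs u f = P u (K f).
  move=> u0; rewrite /rhs /P /three_parts /middle_part -(initial_normE sb1 fb1 u0) muleA.
  by [].
have Y0E f : qnorm Y0 f = N0 (K f) by [].
have Y1E f : qnorm Y1 f = N1 (K f) by [].
have Y0c g : qsum X0 X1 g -> N0 (K g) < +oo -> qcarrier Y0 g by exact: conj.
have Y1c g : qsum X0 X1 g -> N1 (K g) < +oo -> qcarrier Y1 g by exact: conj.
have r_gt0 u : (0 < u)%R -> (0 < r u)%R by exact: rho_gt0.
have Kmono f : nneg_nondecreasing (K f) by exact: Kfun_nneg_nondecreasing.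
have nK f := nneg_nondecreasing_measurable (Kmono f).
have N0_ge0 f : 0 <= N0 (K f).
  exact: (nested_norm_ge0 E0 F0 theta0 sa0 sb0 (measurable_halfline R) (nested_tail R) (nK f)).
have N1_ge0 f : 0 <= N1 (K f).
  exact: (nested_norm_ge0 E1 F1 theta1 sa1 sb1 (measurable_halfline R) (nested_tail R) (nK f)).
have [Q Q1 KQ] := Kfun_quasi_subadditive qX0 qX1.
have Q_gt0 : (0 < Q)%R by exact: lt_le_trans Q1.
have A0 : (0 <= 3 * Q)%R by rewrite mulr_ge0// ltW.
have [C C0 upper] := nested_norms_le_three_parts F0 F1 t0 t1 sa0 sa1 sb0 sb1 fb0 fb1 A0.
have [D0 D00 lower0] := three_parts_le0 F0 F1 t01 sa0 sa1 sb0 sb1 fb0 fb1.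
have [D1 D10 lower1] := three_parts_le1 F0 F1 t01 sa0 sa1 sb0 sb1 fb0 fb1.
pose c := (C + Q * (D0 + D1))%R.
have QD : (0 < Q * (D0 + D1))%R by rewrite mulr_gt0// addr_gt0.
have c0 : (0 < c)%R by rewrite addr_gt0.
exists c => // f u [f0 [f1 [[sf0 n0] [sf1 n1] fE]]] u0.
have sf : qsum X0 X1 f by rewrite fE; exact: qsumD.
have P0 g : 0 <= P u (K g) by exact: three_parts_ge0.
rewrite (rhsE u f u0); split; last first.
  rewrite -lee_pdivrMl//; apply: le_ereal_inf_tmp => _ [g0 [g1 [[sg0 m0] [sg1 m1] fE' ->]]].
  rewrite lee_pdivrMl// Y0E Y1E.
  have /fineK e0 : N0 (K g0) \is a fin_num by rewrite ge0_fin_numE.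
  have /fineK e1 : N1 (K g1) \is a fin_num by rewrite ge0_fin_numE.
  set x := fine _ in e0; set y := fine _ in e1.
  have x0 : (0 <= x)%R by rewrite -lee_fin e0.
  have y0 : (0 <= y)%R by rewrite -lee_fin e1.
  have fK s : (0 < s)%R -> K f s <= Q%:E * (K g0 s + K g1 s).
    by move=> s0; rewrite fE'; exact: KQ.
  apply: le_trans (three_parts_quasi theta0 theta1 F0 F1 sa0 sa1 sb0 sb1 fb0 fb1 (ltW Q_gt0) u0
    (nK f) (nK g0) (nK g1) fK) _.
  have l0 := lower0 u x (K g0) u0 x0 (Kmono g0) (esym e0).
  have l1 := lower1 u y (K g1) u0 y0 (Kmono g1) (esym e1).
  apply: le_trans (lee_wpmul2l _ (leeD l0 l1)) _; first by rewrite lee_fin ltW.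
  rewrite -e0 -e1 -?EFinM -?EFinD -?EFinM lee_fin -/(r u).
  have ry : (0 <= r u * y)%R by apply: mulr_ge0 y0; exact/ltW/r_gt0.
  have p1 : (0 <= Q * D1 * x)%R by rewrite !mulr_ge0// ltW.
  have p2 : (0 <= Q * D0 * (r u * y))%R by apply: mulr_ge0 ry; rewrite mulr_ge0// ltW.
  have p3 : (0 <= C * (x + r u * y))%R.
    by apply: mulr_ge0; [exact: ltW|exact: addr_ge0].
  rewrite /c; move: ry p2 p3; set z := (r u * y)%R; lra.
have /fineK kE := Kfun_fin_num qX0 qX1 u0 sf.
set k := fine _ in kE.
have k0 : (0 <= k)%R by rewrite -lee_fin kE; exact: (Kmono f).1.
have le_c : C%:E * P u (K f) <= c%:E * P u (K f).
  by apply: lee_wpmul2r => //; rewrite lee_fin lerDl ltW.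
(* A decomposition optimal up to a factor 2 comes from K(u, f) < 2 K(u, f). If
   K(u, f) = 0, then K(., f) vanishes and f itself has norm 0 in the first space. *)
apply: le_trans le_c; have [k00|kn0] := eqVneq k 0%R.
  have Kf0 s : (0 < s)%R -> K f s = 0.
    move=> s0; apply/le_anti/andP; split; last exact: (Kmono f).1.
    have [su|/ltW us] := leP s u.
      by apply: le_trans ((Kmono f).2 s u s0 su) _; rewrite -/(Kfun _ _ _ _) /K -kE k00.
    have us0 : (0 < u / s)%R by rewrite divr_gt0.
    have := Kfun_scale qX0 qX1 f u0 us; rewrite -kE k00.
    rewrite /K; have /fineK <- := Kfun_fin_num qX0 qX1 s0 sf.
    by rewrite -EFinM !lee_fin pmulr_rle0.
  have [c00 n00] := qnorm0 qX0.
  have K00 s : (0 < s)%R -> K 0%R s = 0.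
    move=> s0; apply/le_anti/andP; split; last exact: (Kmono _).1.
    by have := Kfun_le_qnorm0 qX1 s c00; rewrite n00.
  have N0f : N0 (K f) = 0 by exact: (nested_norm_eq0 E0 F0 theta0 sa0 sb0 (nK f) Kf0).
  have N10 : N1 (K 0%R) = 0 by exact: (nested_norm_eq0 E1 F1 theta1 sa1 sb1 (nK _) K00).
  apply: (@le_trans _ _ 0); last by apply: mule_ge0 => //; rewrite lee_fin ltW.
  apply: ereal_inf_lbound; exists f, 0%R; split.
  - by apply: (Y0c f sf); rewrite N0f ltry.
  - by apply: (Y1c _ (qsum_l qX1 c00)); rewrite N10 ltry.
  - by rewrite addr0.
  - by rewrite Y0E Y1E N0f N10 mule0 adde0.
have kgt0 : (0 < k)%R by rewrite lt_neqAle eq_sym kn0.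
have : Kfun X0 X1 u f < (2 * k)%:E by rewrite -kE lte_fin ltr_pMl// ltr1n.
move=> /Kfun_lt[g0 [g1 [cg0 cg1 fE' lt]]].
have /fineK e0 := qb_fin_num qX0 cg0; have /fineK e1 := qb_fin_num qX1 cg1.
have := qb_norm_ge0 qX0 cg0; have := qb_norm_ge0 qX1 cg1.
move: lt; rewrite -e0 -e1 -EFinM -EFinD !lee_fin lte_fin.
set p := fine _ in e0 *; set q := fine _ in e1 * => lt q0 p0.
have sg0 := qsum_l qX1 cg0; have sg1 := qsum_r qX0 cg1.
have [cNg0 nNg0] := qnormN qX0 cg0; have [cNg1 nNg1] := qnormN qX1 cg1.
have pk : (p <= 2 * k)%R.
  by apply: le_trans (ltW lt); rewrite lerDl mulr_ge0// ltW.
have uq : (q <= 2 * k / u)%R.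
  by rewrite ler_pdivlMr// mulrC; apply: le_trans (ltW lt); rewrite lerDr.
have Kfin s : (0 < s)%R -> K f s = (fine (K f s))%:E.
  by move=> s0; rewrite fineK//; exact: Kfun_fin_num.
(* Below u, compare with f = g0 + g1 and use that K(s, f)/s decreases. *)
have h0 s : (0 < s)%R -> (s <= u)%R -> K g0 s <= (3 * Q)%:E * K f s.
  move=> s0 su; have g0E : g0 = (f - g1)%R by rewrite fE' addrK.
  have := KQ s f (- g1)%R s0 sf (qsum_r qX0 cNg1); rewrite -g0E => /le_trans; apply.
  have sc := Kfun_scale qX0 qX1 f s0 su.
  have kq := Kfun_le_qnorm1 qX0 s cNg1; rewrite nNg1 -e1 in kq.
  apply: le_trans (lee_wpmul2l _ (leeD (lexx _) kq)) _; first by rewrite lee_fin ltW.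
  move: sc; rewrite -kE -/(K f s) (Kfin s s0) -?EFinM -?EFinD -?EFinM !lee_fin => sc.
  rewrite (mulrC 3%R) -mulrA ler_pM2l//.
  have : (s * q <= s * (2 * k / u))%R by rewrite ler_pM2l.
  have -> : (s * (2 * k / u) = 2 * (s / u * k))%R by field; rewrite gt_eqF.
  lra.
have h0' s : (u <= s)%R -> K g0 s <= (2 * k)%:E.
  move=> us; apply: le_trans (Kfun_le_qnorm0 qX1 s cg0) _.
  by rewrite -e0 lee_fin.
(* Above u, compare with f = g0 + g1 and use that K(s, f) increases. *)
have h1 s : (u <= s)%R -> K g1 s <= (3 * Q)%:E * K f s.
  move=> us; have s0 : (0 < s)%R by exact: lt_le_trans us.
  have g1E : g1 = (f - g0)%R by rewrite fE' addrC addKr.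
  have := KQ s f (- g0)%R s0 sf (qsum_l qX1 cNg0); rewrite -g1E => /le_trans; apply.
  have sc := (Kmono f).2 u s u0 us.
  have kq := Kfun_le_qnorm0 qX1 s cNg0; rewrite nNg0 -e0 in kq.
  apply: le_trans (lee_wpmul2l _ (leeD (lexx _) kq)) _; first by rewrite lee_fin ltW.
  move: sc; rewrite {1}/K -kE -/(K f s) (Kfin s s0) -?EFinD -?EFinM !lee_fin => sc.
  by rewrite (mulrC 3%R) -mulrA ler_pM2l//; lra.
have h1' s : (0 < s)%R -> (s <= u)%R -> K g1 s <= (2 * k / u * s)%:E.
  move=> s0 su; apply: le_trans (Kfun_le_qnorm1 qX0 s cg1) _.
  by rewrite -e1 -EFinM lee_fin mulrC ler_pM2r.
have key := upper u k (K f) (K g0) (K g1) u0 k0 (Kmono f) (esym kE) (nK g0) (nK g1)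
  h0 h0' h1 h1'.
have [Poo|Pfin] := eqVneq (C%:E * P u (K f)) +oo; first by rewrite Poo leey.
have Sfin : N0 (K g0) + (r u)%:E * N1 (K g1) < +oo.
  by apply: le_lt_trans key _; rewrite ltey.
have r0 : 0 < (r u)%:E by rewrite lte_fin r_gt0.
have S1 : 0 <= (r u)%:E * N1 (K g1) by rewrite mule_ge0// ltW.
have N0fin : N0 (K g0) < +oo by apply: le_lt_trans Sfin; rewrite leeDl.
have N1fin : N1 (K g1) < +oo.
  rewrite ltey; apply/eqP => N1oo; move: Sfin.
  rewrite N1oo (gt0_muley r0) addey ?ltxx// gt_eqF//.
  exact: lt_le_trans (ltNyr 0%R) (N0_ge0 g0).
apply: le_trans key; apply: ereal_inf_lbound; exists g0, g1; split.
- exact: Y0c sg0 N0fin.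
- exact: Y1c sg1 N1fin.
- exact: fE'.
- by rewrite Y0E Y1E.
Qed.
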